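(* Let $\lambda_1,\lambda_2>0$, $\alpha_1,\alpha_2\in(0,1)$, and let $S_{\alpha_1,\alpha_2}(t)=N_1(D_{\alpha_1}(t))-N_2(D_{\alpha_2}(t))$ be the space-fractional Skellam process. Its Lévy density is $$\nu_{S_{\alpha_1,\alpha_2}}(x)=\lambda_1^{\alpha_1}\sum_{n_1=1}^\infty(-1)^{n_1+1}\binom{\alpha_1}{n_1}\delta_{n_1}(x)+\lambda_2^{\alpha_2}\sum_{n_2=1}^\infty(-1)^{n_2+1}\binom{\alpha_2}{n_2}\delta_{-n_2}(x).$$
   Context: $N_1,N_2$ are independent homogeneous Poisson processes with intensities $\lambda_1,\lambda_2$; $D_{\alpha_1},D_{\alpha_2}$ are independent stable subordinators, $\mathbb{E}[e^{-sD_{\alpha_i}(t)}]=e^{-ts^{\alpha_i}}$, independent of $N_1,N_2$. $\delta_n$ is the Dirac delta concentrated at $n$ (the ''Lévy density'' denotes the Lévy measure written as a combination of Dirac deltas), and $\binom{\alpha}{n}=\alpha(\alpha-1)\cdots(\alpha-n+1)/n!$. The Lévy measure $\nu$ is the one in $\mathbb{E}[e^{i\theta S_{\alpha_1,\alpha_2}(t)}]=\exp\left(t\int_{\mathbb{R}\setminus\{0\}}(e^{i\theta x}-1)\,\nu(dx)\right)$. *)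

(* Defs.v *)
From mathcomp Require Import all_boot all_order all_algebra.
From mathcomp Require Import complex.
From mathcomp Require Import all_classical all_reals all_analysis.

Set Implicit Arguments.
Unset Strict Implicit.
Unset Printing Implicit Defensive.

Import Order.TTheory GRing.Theory Num.Theory.
Import numFieldNormedType.Exports.

Local Open Scope classical_set_scope.
Local Open Scope ring_scope.

(* Complex exponential; [R[i]] carries no exponential in the library. *)
Definition cexp {R : realType} (z : R[i]) : R[i] :=
  Complex (expR (complex.Re z) * cos (complex.Im z))
          (expR (complex.Re z) * sin (complex.Im z)).

Definition Cintegrable d (T : measurableType d) (R : realType)
    (mu : {measure set T -> \bar R}) (D : set T) (f : T -> R[i]) : Prop :=
  mu.-integrable D (fun x => (complex.Re (f x))%:E) /\
  mu.-integrable D (fun x => (complex.Im (f x))%:E).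

Definition Cintegral d (T : measurableType d) (R : realType)
    (mu : {measure set T -> \bar R}) (D : set T) (f : T -> R[i]) : R[i] :=
  Complex (Rintegral mu D (fun x => complex.Re (f x)))
          (Rintegral mu D (fun x => complex.Im (f x))).

Section processes.
Context d (T : measurableType d) (R : realType) (P : probability T R).

Definition independent_classes (I : finType) (F : I -> set_system T) : Prop :=
  forall (J : {set I}) (E : I -> set T),
    (forall i, i \in J -> F i (E i)) ->
    P (\bigcap_(i in [set` J]) E i) = (\prod_(i in J) P (E i))%E.

(* Processes are indexed by [R]; only the times [t >= 0] are meaningful. *)
Definition process_sigma_algebra d' (T' : measurableType d') (X : R -> T -> T') :
    set_system T :=
  <<s \bigcup_(t in [set t : R | 0 <= t])
        preimage_set_system [set: T] (X t) measurable >>.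

Definition independent_increments (X : R -> T -> R) : Prop :=
  forall (n : nat) (t : nat -> R),
    0 <= t 0%N -> (forall i, t i <= t i.+1) ->
    independent_classes (fun i : 'I_n =>
      preimage_set_system [set: T]
        (fun w => X (t i.+1) w - X (t i) w) measurable).

Definition stationary_increments (X : R -> T -> R) : Prop :=
  forall (s t : R) (B : set R), 0 <= s -> s <= t -> measurable B ->
    P [set w | B (X t w - X s w)] = P [set w | B (X (t - s) w)].

(* Left limits are automatic for monotone paths. *)
Definition increasing_cadlag_path (x : R -> R) : Prop :=
  [/\ x 0 = 0,
      forall s t, 0 <= s -> s <= t -> x s <= x t &
      forall t, 0 <= t -> x s @[s --> t^'+] --> x t].

Definition poisson_process (lambda : R) (N : R -> {RV P >-> nat}) : Prop :=
  [/\ forall w, increasing_cadlag_path (fun t => (N t w)%:R),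
      independent_increments (fun t w => (N t w)%:R) &
      forall (s t : R) (k : nat), 0 <= s -> s < t ->
        P [set w | N t w = (N s w + k)%N] =
        (poisson_pmf (lambda * (t - s)) k)%:E].

Definition stable_subordinator (alpha : R) (D : R -> {RV P >-> R}) : Prop :=
  [/\ forall w, increasing_cadlag_path (fun t => D t w),
      independent_increments (fun t w => D t w),
      stationary_increments (fun t w => D t w) &
      forall s t : R, 0 <= s -> 0 <= t ->
        'E_P[fun w => expR (- (s * D t w))]%E = (expR (- (t * s `^ alpha)))%:E].

Definition space_fractional_skellam
    (N1 N2 : R -> {RV P >-> nat}) (D1 D2 : R -> {RV P >-> R}) : R -> T -> R :=
  fun t w => (N1 (D1 t w) w)%:R - (N2 (D2 t w) w)%:R.

Definition independent_processes
    (N1 N2 : R -> {RV P >-> nat}) (D1 D2 : R -> {RV P >-> R}) : Prop :=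
  independent_classes (fun i : 'I_4 => nth set0
    [:: process_sigma_algebra (fun t w => N1 t w);
        process_sigma_algebra (fun t w => N2 t w);
        process_sigma_algebra (fun t w => D1 t w);
        process_sigma_algebra (fun t w => D2 t w)] i).

Definition is_levy_measure (nu : {measure set (measurableTypeR R) -> \bar R}) :
    Prop :=
  nu [set 0] = 0%E /\ (\int[nu]_x (Num.min 1 (x ^+ 2))%:E < +oo)%E.

(* The integrability clause says that the exponent is a genuine Lebesgue
   integral: [Rintegral] is a junk value otherwise. *)
Definition is_levy_measure_of (X : R -> T -> R)
    (nu : {measure set (measurableTypeR R) -> \bar R}) : Prop :=
  [/\ is_levy_measure nu,
      forall theta : R, Cintegrable nu (~` [set 0])
        (fun x => cexp (Complex 0 (theta * x)) - 1) &
      forall t theta : R, 0 <= t ->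
        Cintegral P [set: T] (fun w => cexp (Complex 0 (theta * X t w))) =
        cexp (Complex t 0 * Cintegral nu (~` [set 0])
          (fun x => cexp (Complex 0 (theta * x)) - 1))].

End processes.

Definition gbinom {R : realType} (alpha : R) (n : nat) : R :=
  (\prod_(i < n) (alpha - i%:R)) / n`!%:R.

Definition skellam_levy_density {R : realType}
    (lambda1 alpha1 lambda2 alpha2 : R) (A : set (measurableTypeR R)) : \bar R :=
  ((lambda1 `^ alpha1)%:E *
     (\sum_(1 <= n <oo) ((-1) ^+ n.+1 * gbinom alpha1 n)%:E *
        \d_(n%:R%R : measurableTypeR R) A) +
   (lambda2 `^ alpha2)%:E *
     (\sum_(1 <= n <oo) ((-1) ^+ n.+1 * gbinom alpha2 n)%:E *
        \d_((- n%:R)%R : measurableTypeR R) A))%E.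

(* Main.v *)
Require Import Defs.
From mathcomp Require Import all_boot all_order all_algebra.
From mathcomp Require Import complex.
From mathcomp Require Import all_classical all_reals all_analysis.
From mathcomp Require Import measurable_realfun.
From mathcomp Require Import ring lra.
Import Order.TTheory GRing.Theory Num.Theory.
Import numFieldNormedType.Exports.

Set Implicit Arguments.
Unset Strict Implicit.
Unset Printing Implicit Defensive.

Local Open Scope classical_set_scope.
Local Open Scope ring_scope.

(** Put b_n = (-1)^(n+1) binom(alpha, n) for n >= 1.  Since 0 < alpha < 1 the
    b_n are nonnegative with sum 1, and 1 - (1 - u)^alpha = sum_n b_n u^n.
    Conditioning a Poisson process N on an independent subordinator D gives
    E[u^N(D(t))] = E[exp (- lambda (1 - u) D(t))], that is
    exp (- t lambda^alpha (1 - u)^alpha), for real u in [0, 1].  This is the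
    generating function of a compound Poisson law of intensity t lambda^alpha
    and jump law b, so the characteristic function of N(D(t)) is
    exp (t lambda^alpha sum_n b_n (e^(i theta n) - 1)): the Levy measure of
    N(D(t)) is lambda^alpha sum_n b_n delta_n.  The difference of the two
    independent copies has the sum of the first measure and of the reflection
    of the second.

    The Laplace transform is known for real arguments only, and is carried to
    the unit circle by power series (compound_charfun): equality of real
    functions on (0, 1) gives equality of coefficients, in the form of the
    recursion F' = c G' F between the coefficients of the generating function F
    and of the jump series G; read on the ray r e^(i theta), the same recursion
    is a linear differential equation in r whose solution is
    exp (c (G - 1)), and Abel's theorem lets r tend to 1.

    The conditioning rests on a time grid (cvg_grid): N is right-continuous, so
    N(D(t)) is the limit of N at the grid point following D(t), and on each grid
    cell independence of the four processes factors the probabilities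
    (joint_pmf).

    Uniqueness (levy_measure_unique) uses that the exponent vanishes at
    theta = 2 pi.  Hence 1 - cos (2 pi x) has integral 0 for any other
    representing measure, which therefore lives on the nonzero integers, where
    min(1, x^2) = 1, so that it is finite there.  Averaging the exponent over
    the frequencies 2 pi j / N, as in the discrete Fourier transform, yields the
    mass of the residue classes m + N Z, and N = 2^k isolates the atom m. *)

(** * Cauchy products and power series on the unit disc *)

Definition convol (R : realType) (a b : R^nat) (k : nat) : R :=
  \sum_(i < k.+1) a i * b (k - i)%N.

Lemma series_convol (R : realType) (a b : R^nat) n :
  series (convol a b) n = \sum_(i < n) a i * series b (n - i)%N.
Proof.
elim: n => [|n IHn]; first by rewrite big_ord0 /series /= big_geq.
rewrite seriesSr IHn /convol.
rewrite [in RHS]big_ord_recr/= subSnn (_ : series b 1 = b 0%N); last first.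
  by rewrite /series /= big_nat1.
rewrite [in LHS]big_ord_recr/= subnn addrA -big_split/=; congr (_ + _).
apply: eq_bigr => i _; rewrite subSn 1?ltnW//.
by rewrite seriesSr mulrDr.
Qed.

Lemma cvg_half : (fun n => n./2) @ \oo --> \oo.
Proof.
apply/cvgnyPge => A; exists (A.*2) => //= n.
by move=> An; rewrite -(doubleK A) half_leq.
Qed.

(** The partial product minus the partial sum of the Cauchy product collects
    the terms a_i b_j with i, j < n and n <= i + j.  Bounded in absolute value,
    these are at most A_n B_n - A_h B_h with h = n/2, where A and B are the sums
    of absolute values, since i, j < h forces i + j < n. *)
Lemma cvg_series_convol (R : realType) (a b : R^nat) :
  cvgn [normed series a] -> cvgn [normed series b] ->
  series (convol a b) @ \oo --> limn (series a) * limn (series b).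
Proof.
move=> ca cb.
have sa := normed_cvg ca; have sb := normed_cvg cb.
pose A := [normed series a]; pose B := [normed series b].
have Am m n : (m <= n)%N -> A m <= A n.
  by apply: nondecreasing_series => i _ _ /=; exact: normr_ge0.
have Bm m n : (m <= n)%N -> B m <= B n.
  by apply: nondecreasing_series => i _ _ /=; exact: normr_ge0.
have A0 n : 0 <= A n by apply: sumr_ge0 => i _; exact: normr_ge0.
have B0 n : 0 <= B n by apply: sumr_ge0 => i _; exact: normr_ge0.
have bd n : `|series a n * series b n - series (convol a b) n| <=
    A n * B n - A n./2 * B n./2.
  apply: (@le_trans _ _ (\sum_(i < n) `|a i| * (B n - B (n - i)%N))).
    rewrite series_convol {1}/series /= big_mkord mulr_suml -sumrB.
    apply: (le_trans (ler_norm_sum _ _ _)); apply: ler_sum => i _.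
    rewrite -mulrBr normrM ler_wpM2l// sub_series_geq ?leq_subr//.
    apply: (le_trans (ler_norm_sum _ _ _)).
    by rewrite sub_series_geq ?leq_subr.
  under eq_bigr do rewrite mulrBr.
  have AE m : A m = \sum_(i < m) `|a i|.
    by rewrite /A /normed_series_of seriesEord.
  rewrite sumrB -mulr_suml -AE lerD2l lerN2 AE mulr_suml.
  have hn : (n./2 <= n)%N by rewrite -divn2 leq_div.
  rewrite -(big_mkord xpredT (fun i => `|a i| * B n./2)).
  rewrite -(big_mkord xpredT (fun i => `|a i| * B (n - i)%N)).
  rewrite [leRHS](big_cat_nat _ hn)//= -[leLHS]addr0 lerD//.
    rewrite !big_nat; apply: ler_sum => i /andP[_ i2].
    rewrite ler_wpM2l//; apply: Bm.
    have : (n./2 + n./2 <= n)%N.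
      by rewrite addnn -[leqRHS](odd_double_half n) leq_addl.
    move=> h; rewrite leq_subRL ?(leq_trans (ltnW i2))//.
    by rewrite (leq_trans _ h)// leq_add2r ltnW.
  by apply: sumr_ge0 => i _; rewrite mulr_ge0.
have h2 : (fun n => A n * B n - A n./2 * B n./2) @ \oo --> (0 : R).
  rewrite -(subrr (limn A * limn B)); apply: cvgB; first exact: cvgM.
  apply: cvgM.
    exact: (cvg_comp _ _ cvg_half ca).
  exact: (cvg_comp _ _ cvg_half cb).
have h3 : (fun n => series a n * series b n - series (convol a b) n) @ \oo
    --> (0 : R).
  apply/cvgr0Pnorm_le => e e0; move/cvgr0Pnorm_le/(_ _ e0): h2.
  apply: filterS => n; apply: le_trans.
  by apply: (le_trans (bd n)); exact: ler_norm.
have -> : series (convol a b) = (fun n => series a n * series b n -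
    (series a n * series b n - series (convol a b) n)).
  by apply/funext => n; rewrite opprB addrCA subrr addr0.
by rewrite -[X in _ --> X]subr0; apply: cvgB => //; exact: cvgM.
Qed.

Definition disc_cvg (R : realType) (c : R^nat) :=
  forall x : R, `|x| < 1 -> cvgn (pseries c x).

Definition psum (R : realType) (c : R^nat) (x : R) := limn (pseries c x).

Lemma disc_norm (R : realType) (c : R^nat) (x : R) : disc_cvg c -> `|x| < 1 ->
  cvgn (pseries (fun i => `|c i|) `|x|).
Proof.
move=> hc x1; have := @is_cvg_pseries_inside_norm R c ((1 + `|x|) / 2) `|x|.
have x0 := normr_ge0 x.
have hK : `|(1 + `|x|) / 2| = (1 + `|x|) / 2 by rewrite ger0_norm//; lra.
by apply; [apply: hc|]; rewrite ?normr_id hK; lra.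
Qed.

Lemma disc_normed (R : realType) (c : R^nat) (x : R) : disc_cvg c ->
  `|x| < 1 -> cvgn [normed series (fun i => c i * x ^+ i)].
Proof.
move=> hc x1; have := disc_norm hc x1.
rewrite /pseries; under eq_fun do rewrite -normrX -normrM; exact.
Qed.

Lemma disc_bounded (R : realType) (c : R^nat) (M : R) :
  (forall n, `|c n| <= M) -> disc_cvg c.
Proof.
move=> cM x x1; apply: normed_cvg.
apply: (@series_le_cvg _ _ (geometric M `|x|)) => [n|n|n|] /=.
- exact: normr_ge0.
- by rewrite mulr_ge0// (le_trans _ (cM 0)).
- by rewrite normrM normrX ler_wpM2r.
- by apply: is_cvg_geometric_series; rewrite normr_id.
Qed.

Lemma disc_mul_bounded (R : realType) (a f : R^nat) : disc_cvg a ->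
  (forall n, `|f n| <= 1) -> disc_cvg (fun n => a n * f n).
Proof.
move=> ha f1 x x1; apply: normed_cvg.
apply: (@series_le_cvg _ _ (fun i => `|a i| * `|x| ^+ i)) => [n|n|n|] /=.
- exact: normr_ge0.
- by rewrite mulr_ge0.
- by rewrite !normrM normrX ler_wpM2r// ler_piMr.
- exact: (disc_norm ha x1).
Qed.

(** The factor n + 1 is absorbed by enlarging the radius: by Bernoulli,
    1 + n d <= (1 + d)^n, and d is chosen so that (1 + d) |x| < 1. *)
Lemma disc_diffs (R : realType) (c : R^nat) :
  disc_cvg c -> disc_cvg (pseries_diffs c).
Proof.
move=> hc x x1; apply: normed_cvg.
have x0 := normr_ge0 x.
pose d := (1 - `|x|) / 2; pose y := (1 + `|x|) / 2.
have d0 : 0 < d by rewrite /d; lra.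
have y0 : 0 < y by rewrite /y; lra.
have y1 : `|y| < 1 by rewrite ger0_norm /y; lra.
have dx : (1 + d) * `|x| <= y by rewrite /d /y; nra.
have bern n : 1 + n%:R * d <= (1 + d) ^+ n.
  elim: n => [|n IHn]; first by rewrite mul0r addr0 expr0.
  rewrite exprS -natr1; have n0 : 0 <= n%:R :> R by [].
  apply: (le_trans _ (ler_wpM2l _ IHn)); last by lra.
  suff : 0 <= n%:R * d * d by lra.
  by have := mulr_ge0 n0 (mulr_ge0 (ltW d0) (ltW d0)); rewrite mulrA.
pose u i := `|c i.+1| * y ^+ i.+1.
apply: (@series_le_cvg _ _ (fun i => ((1 + d) / d / y) * u i)) => [n|n|n|] /=.
- exact: normr_ge0.
- by rewrite /u !mulr_ge0 ?divr_ge0 ?exprn_ge0// ?invr_ge0 ?ltW//; lra.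
- rewrite !normrM normrX (ger0_norm (ler0n _ _)) /u.
  rewrite [leRHS](_ : _ = `|c n.+1| * ((1 + d) / d * y ^+ n)); last first.
    by rewrite exprS; field; rewrite !gt_eqF.
  rewrite mulrAC [leLHS]mulrC ler_wpM2l//.
  rewrite [leRHS]mulrAC ler_pdivlMr// mulrAC.
  apply: (@le_trans _ _ ((1 + d) ^+ n.+1 * `|x| ^+ n)).
    by rewrite ler_wpM2r ?exprn_ge0// (le_trans _ (bern _)) ?lerDr.
  rewrite exprS -mulrA -exprMn ler_wpM2l//; first by lra.
  by rewrite lerXn2r// ?nnegrE ?mulr_ge0//; lra.
- have : cvgn (series u).
    have := disc_norm hc y1; rewrite (gtr0_norm y0) /pseries => hh.
    have : cvgn (fun n =>
        series (fun i => `|c i| * y ^+ i) n.+1 - `|c 0| * y ^+ 0).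
      apply: is_cvgB; last exact: is_cvg_cst.
      by apply: cvgP; rewrite (cvg_shiftS (series _)); exact: hh.
    suff -> : series u = (fun n => series (fun i => `|c i| * y ^+ i) n.+1 -
        `|c 0| * y ^+ 0) by [].
    apply/funext => n.
    by rewrite /series /= big_nat_recl//= [X in X - _]addrC addrK.
  by move=> cu; exact: (@is_cvg_seriesZ _ _ ((1 + d) / d / y) cu).
Qed.

Lemma psum_derive (R : realType) (c : R^nat) (x : R) : disc_cvg c ->
  `|x| < 1 -> is_derive x (1 : R) (psum c) (psum (pseries_diffs c) x).
Proof.
move=> hc x1; have x0 := normr_ge0 x.
have hK : `|(1 + `|x|) / 2| < 1 by rewrite ger0_norm; lra.
apply: (@pseries_snd_diffs _ _ ((1 + `|x|) / 2)).
- exact: hc.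
- exact: (disc_diffs hc).
- exact: (disc_diffs (disc_diffs hc)).
- by rewrite (@ger0_norm _ (_ / _)); lra.
Qed.

Lemma cvg_pseries_convol (R : realType) (a b : R^nat) (x : R) :
  disc_cvg a -> disc_cvg b -> `|x| < 1 ->
  pseries (convol a b) x @ \oo --> psum a x * psum b x.
Proof.
move=> ha hb x1.
have := cvg_series_convol (disc_normed ha x1) (disc_normed hb x1).
suff -> : pseries (convol a b) x = series (convol (fun i => a i * x ^+ i)
  (fun i => b i * x ^+ i)) by [].
apply/funext => n; apply: eq_bigr => k _; rewrite /convol /= mulr_suml.
apply: eq_bigr => i _; rewrite [RHS]mulrACA -exprD subnKC//.
by rewrite -ltnS.
Qed.

Lemma disc_convol (R : realType) (a b : R^nat) : disc_cvg a -> disc_cvg b ->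
  disc_cvg (convol a b).
Proof.
by move=> ha hb x x1; apply: cvgP; exact: (cvg_pseries_convol ha hb x1).
Qed.

Lemma psum_convol (R : realType) (a b : R^nat) (x : R) : disc_cvg a ->
  disc_cvg b -> `|x| < 1 -> psum (convol a b) x = psum a x * psum b x.
Proof. by move=> ha hb x1; apply: cvg_lim => //; exact: cvg_pseries_convol. Qed.

Lemma psumD (R : realType) (a b : R^nat) (x : R) : disc_cvg a -> disc_cvg b ->
  `|x| < 1 -> psum (fun n => a n + b n) x = psum a x + psum b x.
Proof.
move=> ha hb x1; rewrite /psum -lim_seriesD; [|exact: ha|exact: hb].
by congr (limn (series _)); apply/funext => n; rewrite /= mulrDl.
Qed.

Lemma psumZ (R : realType) (a : R^nat) (k x : R) : disc_cvg a ->
  `|x| < 1 -> psum (fun n => k * a n) x = k * psum a x.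
Proof.
move=> ha x1; rewrite /psum -[RHS]lim_seriesZ; last exact: ha.
by congr (limn (series _)); apply/funext => n; rewrite /= -mulrA.
Qed.

Lemma discZ (R : realType) (a : R^nat) (k : R) : disc_cvg a ->
  disc_cvg (fun n => k * a n).
Proof.
move=> ha x x1; have := @is_cvg_seriesZ _ _ k (ha x x1).
suff -> : pseries (fun n => k * a n) x = series (k *: (fun i => a i * x ^+ i)).
  by [].
by congr series; apply/funext => n; rewrite /= -mulrA.
Qed.

Lemma discD (R : realType) (a b : R^nat) : disc_cvg a -> disc_cvg b ->
  disc_cvg (fun n => a n + b n).
Proof.
move=> ha hb x x1; have := is_cvg_seriesD (ha x x1) (hb x x1).
suff -> : pseries (fun n => a n + b n) x =
  series ((fun i => a i * x ^+ i) + (fun i => b i * x ^+ i)) by [].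
by congr series; apply/funext => n; rewrite /= mulrDl.
Qed.

Lemma cvg_psum_natM (R : realType) (c : R^nat) (x : R) : disc_cvg c ->
  `|x| < 1 ->
  pseries (fun n => n%:R * c n) x @ \oo --> x * psum (pseries_diffs c) x.
Proof.
move=> hc x1; rewrite -cvg_shiftS /=.
have -> : (fun n => pseries (fun n => n%:R * c n) x n.+1) =
    (fun n => x * pseries (pseries_diffs c) x n).
  apply/funext => n; rewrite /pseries /series /= big_nat_recl//= !mul0r add0r.
  rewrite mulr_sumr; apply: eq_bigr => i _.
  by rewrite /pseries_diffs exprS mulrCA.
by apply: cvgM; [exact: cvg_cst|exact: (disc_diffs hc)].
Qed.

Lemma disc_natM (R : realType) (c : R^nat) : disc_cvg c ->
  disc_cvg (fun n => n%:R * c n).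
Proof. by move=> hc x x1; apply: cvgP; exact: (cvg_psum_natM hc x1). Qed.

Lemma psum_natM (R : realType) (c : R^nat) (x : R) : disc_cvg c -> `|x| < 1 ->
  psum (fun n => n%:R * c n) x = x * psum (pseries_diffs c) x.
Proof.
by move=> hc x1; apply: cvg_lim => //; exact: (cvg_psum_natM hc x1).
Qed.

Lemma deriv0_cst (R : realType) (f : R -> R) :
  (forall x, `|x| < 1 -> is_derive x (1 : R) f 0) ->
  forall x, 0 <= x < 1 -> f x = f 0.
Proof.
move=> hf x /andP[x0 x1].
have h z : z \in `[0, x] -> `|z| < 1.
  by rewrite in_itv/= => /andP[z0 zx]; rewrite ger0_norm// (le_lt_trans zx).
have [| | c _] := @MVT_segment _ f (fun=> 0) 0 x x0.
- by move=> z /subset_itv_oo_cc /h /hf.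
- apply: derivable_within_continuous ; by move=> z /h /hf[].
- by rewrite mul0r => /eqP; rewrite subr_eq0 => /eqP.
Qed.

Lemma psum0 (R : realType) (c : R^nat) : psum c 0 = c 0%N.
Proof.
rewrite /psum; apply: cvg_lim => //; rewrite -cvg_shiftS.
have -> : [sequence (pseries c 0) n.+1]_n = cst (c 0%N).
  apply/funext => n; rewrite /= /pseries /series /= big_nat_recl//=.
  by rewrite big1 ?addr0 ?mulr1// => i _; rewrite expr0n/= mulr0.
exact: cvg_cst.
Qed.

Lemma psum_shift (R : realType) (c : R^nat) (x : R) : disc_cvg c -> `|x| < 1 ->
  x != 0 -> pseries (fun n => c n.+1) x @ \oo --> (psum c x - c 0%N) / x.
Proof.
move=> hc x1 xN0.
have -> : pseries (fun n => c n.+1) x =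
   (fun n => (pseries c x n.+1 - c 0%N) / x).
  apply/funext => n; rewrite /pseries /series /= big_nat_recl//= expr0 mulr1.
  rewrite addrC addKr mulr_suml; apply: eq_bigr => i _.
  by rewrite exprS mulrCA mulrAC mulfV ?mul1r.
apply: cvgM; last exact: cvg_cst.
by apply: cvgB; [rewrite cvg_shiftS; exact: hc|exact: cvg_cst].
Qed.

Lemma psum_continuous (R : realType) (c : R^nat) (x : R) : disc_cvg c ->
  `|x| < 1 -> {for x, continuous (psum c)}.
Proof.
move=> hc x1; apply: differentiable_continuous; apply/derivable1_diffP.
by have [] := psum_derive hc x1.
Qed.

Lemma near_right01 (R : realType) : \forall x \near (0 : R)^'+, 0 < x < 1.
Proof.
near=> x; apply/andP; split; near: x; first exact: nbhs_right_gt.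
exact: nbhs_right_lt.
Unshelve. all: by end_near. Qed.

(** The constant coefficient is the limit at 0+, and dividing by x shifts the
    coefficients. *)
Lemma psum_eq0 (R : realType) (c : R^nat) : disc_cvg c ->
  (forall x, 0 < x < 1 -> psum c x = 0) -> c =1 (fun=> 0).
Proof.
have c00 (b : R^nat) : disc_cvg b ->
    (forall x, 0 < x < 1 -> psum b x = 0) -> b 0%N = 0.
  move=> hb b0; rewrite -psum0.
  have /cvg_at_right_filter h : psum b x @[x --> 0] --> psum b 0.
    by apply: psum_continuous => //; rewrite normr0.
  apply: (cvg_unique _ h) => //.
  apply/cvgrPdist_le => e e0; have := near_right01 R.
  by apply: filterS => x /b0 ->; rewrite subr0 normr0 ltW.
move=> hc c0 n; elim: n c hc c0 => [|n IHn] c hc c0; first exact: c00.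
apply: (IHn (fun k => c k.+1)).
  move=> x x1; have [->|xN0] := eqVneq x 0; last first.
    exact/cvgP/(psum_shift hc x1 xN0).
  have h2 : `|2^-1 : R| < 1 by rewrite ger0_norm; lra.
  apply: (@is_cvg_pseries_inside _ _ (2^-1)); last by rewrite normr0 normr_gt0.
  by apply/cvgP/(psum_shift hc h2); rewrite invr_eq0.
move=> x /andP[x0 x1]; have x1' : `|x| < 1 by rewrite gtr0_norm.
have := psum_shift hc x1' (lt0r_neq0 x0); rewrite c0 ?x0//.
rewrite c00// subr0 mul0r => h.
exact: (cvg_lim _ h).
Qed.

Lemma norm_lim_series_le (R : realType) (u v : R^nat) : cvgn (series v) ->
  (forall n, `|u n| <= v n) -> `|limn (series u)| <= limn (series v).
Proof.
move=> cv uv; have cu : cvgn [normed series u].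
  by apply: (series_le_cvg _ _ _ cv) => //= n; exact: (le_trans _ (uv n)).
by apply: (le_trans (lim_series_norm cu)); exact: lim_series_le.
Qed.

(** Abel's theorem, dominated by a nonnegative series for which the
    conclusion is known: the deviation of the weighted sums at r from those at 1
    is at most S - sum p_n r^n. *)
Lemma abel_limit (R : realType) (p f : R^nat) (S : R) :
  (forall n, 0 <= p n) -> (forall n, `|f n| <= 1) ->
  series p @ \oo --> S ->
  psum p r @[r --> 1^'-] --> S ->
  cvgn (series (fun n => p n * f n)) /\
  psum (fun n => p n * f n) r @[r --> 1^'-] -->
    limn (series (fun n => p n * f n)).
Proof.
move=> p0 f1 pS hp.
have cpf : cvgn (series (fun n => p n * f n)).
  apply: normed_cvg; apply: (@series_le_cvg _ _ p) => //= [n|].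
    by rewrite normrM ger0_norm// ler_piMr.
  by apply/cvgP; exact: pS.
split=> //.
have pb n : `|p n| <= S.
  rewrite ger0_norm// -(cvg_lim _ pS)//.
  apply: (@le_trans _ _ (series p n.+1)).
    by rewrite /series /= big_nat_recr//= lerDr sumr_ge0.
  apply: nondecreasing_cvgn_le; last exact/cvgP/pS.
  by move=> m k; apply: nondecreasing_series.
have dp := disc_bounded pb.
have dpf : disc_cvg (fun n => p n * f n).
  apply: (@disc_bounded _ _ S) => n.
  by rewrite normrM (le_trans _ (pb n))// ler_piMr.
apply/cvgrPdist_le => e e0; near=> r.
have r0 : 0 < r by near: r; apply: nbhs_left_gt.
have r1 : r < 1 by near: r; apply: nbhs_left_lt.
have r1' : `|r| < 1 by rewrite gtr0_norm.
apply: (@le_trans _ _ (S - psum p r)); last first.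
  apply: (le_trans (ler_norm _)).
  by near: r; move/cvgrPdist_le : hp; apply.
have cp : cvgn (series p) by exact/cvgP/pS.
rewrite -(cvg_lim _ pS)// /psum.
have -> : limn (series p) - limn (pseries p r) =
    limn (series (p - (fun i => p i * r ^+ i))).
  by rewrite lim_seriesB//; exact: dp.
have -> : limn (series (fun n => p n * f n)) -
    limn (pseries (fun n => p n * f n) r) =
    limn (series ((fun n => p n * f n) - (fun i => p i * f i * r ^+ i))).
  by rewrite lim_seriesB//; exact: dpf.
apply: norm_lim_series_le.
  by apply: is_cvg_seriesB => //; exact: dp.
move=> n; rewrite !fctE mulrAC -mulrBl normrM -[leRHS]ger0_norm ?ler_piMr//.
by rewrite subr_ge0 ler_piMr// exprn_ile1// ltW.
Unshelve. all: by end_near. Qed.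

(** * The binomial series of 1 - (1 - u)^alpha *)

(** Includes the value -1 at n = 0, which makes the recursion
    signed_binomS hold from n = 0 on. *)
Definition signed_binom (R : realType) (alpha : R) (n : nat) : R :=
  (-1) ^+ n.+1 * gbinom alpha n.

Lemma signed_binomS (R : realType) (alpha : R) n :
  n.+1%:R * signed_binom alpha n.+1 = (n%:R - alpha) * signed_binom alpha n.
Proof.
rewrite /signed_binom /gbinom big_ord_recr/= factS natrM exprS.
have n1 : n.+1%:R != 0 :> R by rewrite pnatr_eq0.
have nf : n`!%:R != 0 :> R by rewrite pnatr_eq0 -lt0n fact_gt0.
by field; rewrite nf nat1r n1.
Qed.

Lemma signed_binom0 (R : realType) (alpha : R) : signed_binom alpha 0 = -1.
Proof. by rewrite /signed_binom /gbinom big_ord0 expr1 fact0 divr1 mulr1. Qed.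

Lemma signed_binomSE (R : realType) (alpha : R) n :
  signed_binom alpha n.+1 = (n%:R - alpha) / n.+1%:R * signed_binom alpha n.
Proof.
have n1 : n.+1%:R != 0 :> R by rewrite pnatr_eq0.
apply: (mulfI n1); rewrite signed_binomS [RHS]mulrA mulrC.
by rewrite [_ * (_ / _)]mulrC divfK// mulrC.
Qed.

Lemma signed_binom_ge0 (R : realType) (alpha : R) n : 0 < alpha < 1 ->
  0 <= signed_binom alpha n.+1.
Proof.
move=> /andP[a0 a1]; elim: n => [|n IHn].
  by rewrite signed_binomSE signed_binom0 sub0r divr1 mulrNN mulr1 ltW.
rewrite signed_binomSE mulr_ge0// divr_ge0// subr_ge0 (le_trans (ltW a1))//.
by rewrite ler1n.
Qed.

Lemma signed_binom_norm (R : realType) (alpha : R) n : 0 < alpha < 1 ->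
  `|signed_binom alpha n| <= 1.
Proof.
move=> /andP[a0 a1]; elim: n => [|n IHn].
  by rewrite signed_binom0 normrN normr1.
rewrite signed_binomSE normrM mulr_ile1// normrM normfV.
rewrite (ger0_norm (ler0n _ _)) ler_pdivrMr// mul1r ler_norml -natr1.
by have : 0 <= n%:R :> R by []; lra.
Qed.

Lemma disc_signed_binom (R : realType) (alpha : R) : 0 < alpha < 1 ->
  disc_cvg (signed_binom alpha).
Proof.
by move=> a01; apply: (disc_bounded (M := 1)) => n; exact: signed_binom_norm.
Qed.

(** The coefficient recursion is the differential equation
    (1 - z) y' = - alpha y, so y (1 - z)^(- alpha) is constant. *)
Lemma psum_signed_binom (R : realType) (alpha x : R) : 0 < alpha < 1 ->
  0 <= x < 1 -> psum (signed_binom alpha) x = - (1 - x) `^ alpha.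
Proof.
move=> a01 x01; set y := psum (signed_binom alpha).
have hb := disc_signed_binom a01.
pose y' := psum (pseries_diffs (signed_binom alpha)).
have ode z : `|z| < 1 -> (1 - z) * y' z = - alpha * y z.
  move=> z1; rewrite mulrBl mul1r {2}/y' -psum_natM//.
  rewrite {1}/y' (_ : pseries_diffs _ =
    fun n => n%:R * signed_binom alpha n + (- alpha) * signed_binom alpha n).
    rewrite psumD// ?psumZ//; [|exact: disc_natM|exact: discZ].
    by rewrite addrAC subrr add0r.
  by apply/funext => n; rewrite /pseries_diffs signed_binomS mulrDl.
pose h z := y z * (1 - z) `^ (- alpha).
have hd z : `|z| < 1 -> is_derive z (1 : R) h 0.
  move=> z1; have z1' : 0 < 1 - z.
    by rewrite subr_gt0 (le_lt_trans (ler_norm _)).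
  have d1 := psum_derive hb z1; rewrite -/y -/(y' z) in d1.
  have d2 : is_derive z (1 : R) (fun z => 1 - z) (- 1).
    apply: (is_derive_eq (is_deriveB (is_derive_cst (1 : R) z 1)
      (is_derive_id z 1))).
    by rewrite sub0r.
  have d3 := @is_derive1_comp R (fun u => u `^ (- alpha)) (fun z => 1 - z) z _ _
    (is_derive1_powR (- alpha) z1') d2.
  have d4 := is_deriveM d1 d3.
  apply: (is_derive_eq d4).
  rewrite /= /GRing.scale /=.
  have -> : (1 - z) `^ (- alpha) = (1 - z) * (1 - z) `^ (- alpha - 1).
    rewrite -{2}(powRr1 (ltW z1')) -powRD ?(gt_eqF z1') ?implybT//.
    by rewrite addrCA subrr addr0.
  rewrite [X in _ + X]mulrAC ode//; ring.
have := deriv0_cst hd x01; rewrite /h subr0 powR1 mulr1 /y psum0 signed_binom0.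
have x1' : 0 < 1 - x by rewrite subr_gt0; case/andP : x01.
rewrite powRN => /(canRL (mulfVK _)); rewrite mulN1r; apply.
by rewrite gt_eqF// powR_gt0.
Qed.

(** The jump law of the compound Poisson process; vanishing at 0, it may be
    summed from 0. *)
Definition levy_weight (R : realType) (alpha : R) (n : nat) : R :=
  if n is 0 then 0 else signed_binom alpha n.

Lemma levy_weight_ge0 (R : realType) (alpha : R) n : 0 < alpha < 1 ->
  0 <= levy_weight alpha n.
Proof. by move=> a01; case: n => //= n; exact: signed_binom_ge0. Qed.

Lemma disc_levy_weight (R : realType) (alpha : R) : 0 < alpha < 1 ->
  disc_cvg (levy_weight alpha).
Proof.
move=> a01; apply: (disc_bounded (M := 1)) => -[|n]; first by rewrite normr0.
exact: signed_binom_norm.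
Qed.

Lemma psum_levy_weight (R : realType) (alpha x : R) : 0 < alpha < 1 ->
  0 <= x < 1 -> psum (levy_weight alpha) x = 1 - (1 - x) `^ alpha.
Proof.
move=> a01 x01.
have x1 : `|x| < 1 by case/andP : x01 => ? ?; rewrite ger0_norm.
have hd : disc_cvg (fun n => (n == 0%N)%:R : R).
  by apply: (disc_bounded (M := 1)) => -[|n]; rewrite ?normr1 ?normr0.
have -> : levy_weight alpha = fun n => signed_binom alpha n + (n == 0%N)%:R.
  by apply/funext => -[|n]; rewrite /= ?addr0// signed_binom0 addNr.
rewrite psumD//; last exact: disc_signed_binom.
rewrite psum_signed_binom// addrC; congr (_ - _).
apply: cvg_lim => //; rewrite -cvg_shiftS.
have -> : [sequence (pseries (fun n => (n == 0%N)%:R) x) n.+1]_n = cst (1 : R).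
  apply/funext => n; rewrite /= /pseries /series /= big_nat_recl//=.
  by rewrite big1 ?addr0 ?mulr1// => i _; rewrite mul0r.
exact: cvg_cst.
Qed.

Lemma cvg_powR_1B (R : realType) (alpha : R) : 0 < alpha ->
  (1 - r) `^ alpha @[r --> 1^'-] --> (0 : R).
Proof.
move=> a0; apply: (cvg_comp _ _ _ (powR_cvg0 a0)).
move=> A /= [e e0 H]; near=> r; apply: H => /=.
  rewrite sub0r normrN ger0_norm ?subr_ge0//.
  near: r; apply: nbhs_left_ltBl => //.
by rewrite subr_gt0; near: r; exact: nbhs_left_lt.
Unshelve. all: by end_near. Qed.

Lemma cvg_psum_levy_weight (R : realType) (alpha : R) : 0 < alpha < 1 ->
  psum (levy_weight alpha) r @[r --> 1^'-] --> (1 : R).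
Proof.
move=> a01; have /andP[a0 _] := a01.
have h : 1 - (1 - r) `^ alpha @[r --> 1^'-] --> (1 - 0 : R).
  by apply: cvgB; [exact: cvg_cst|exact: (cvg_powR_1B a0)].
rewrite -[X in _ --> X]subr0; apply: cvg_trans h.
apply: near_eq_cvg; near=> r; rewrite psum_levy_weight//.
by apply/andP; split; near: r; [exact: nbhs_left_ge|exact: nbhs_left_lt].
Unshelve. all: by end_near. Qed.

(** Partial sums at r < 1 are at most 1 - (1 - r)^alpha <= 1, hence so are
    those at 1; conversely the sum dominates 1 - (1 - r)^alpha for all r < 1. *)
Lemma cvg_series_levy_weight (R : realType) (alpha : R) : 0 < alpha < 1 ->
  series (levy_weight alpha) @ \oo --> (1 : R).
Proof.
move=> a01; have hd := disc_levy_weight a01.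
have h1 := cvg_psum_levy_weight a01.
have nd : nondecreasing_seq (series (levy_weight alpha)).
  by apply: nondecreasing_series => n _ _; exact: levy_weight_ge0.
have le_psum N r : 0 <= r < 1 ->
    \sum_(0 <= k < N) levy_weight alpha k * r ^+ k <= 1.
  move=> r01; have /andP[r0 r1] := r01.
  apply: (@le_trans _ _ (psum (levy_weight alpha) r)).
    apply: (@nondecreasing_cvgn_le _ (pseries (levy_weight alpha) r)).
      apply: nondecreasing_series => n _ _.
      by rewrite mulr_ge0 ?levy_weight_ge0// exprn_ge0.
    by apply: hd; rewrite ger0_norm.
  by rewrite psum_levy_weight// gerBl powR_ge0.
have le1 N : series (levy_weight alpha) N <= 1.
  have h : \sum_(0 <= k < N) levy_weight alpha k * r ^+ k @[r --> 1^'-] -->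
      \sum_(0 <= k < N) levy_weight alpha k * 1 ^+ k.
    apply: cvg_at_left_filter.
    apply: cvg_big => [|i _]; first exact: add_continuous.
    apply: cvgM; first exact: cvg_cst.
    exact: exprn_continuous.
  have -> : series (levy_weight alpha) N =
      \sum_(0 <= k < N) levy_weight alpha k * 1 ^+ k.
    by apply: eq_bigr => i _; rewrite expr1n mulr1.
  apply: (cvgr_to_le h); near=> r; apply: le_psum.
  by apply/andP; split; near: r; [exact: nbhs_left_ge|exact: nbhs_left_lt].
have cs : cvgn (series (levy_weight alpha)).
  by apply: nondecreasing_is_cvgn => //; exists 1 => _ [n _ <-].
suff <- : limn (series (levy_weight alpha)) = 1 by [].
apply/eqP; rewrite eq_le; apply/andP; split.
  by apply: limr_le => //; near=> n; exact: le1.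
apply: (cvgr_to_le h1); near=> r.
have r0 : 0 <= r by near: r; exact: nbhs_left_ge.
have r1 : r < 1 by near: r; exact: nbhs_left_lt.
apply: lim_series_le => //; first by apply: hd; rewrite ger0_norm.
by move=> n; rewrite ler_piMr ?levy_weight_ge0// exprn_ile1// ltW.
Unshelve. all: by end_near. Qed.

(** * From the generating function on [0, 1) to the unit circle *)

Section compound.
Context (R : realType) (alpha c : R) (p : R^nat).
Hypotheses (a01 : 0 < alpha < 1) (p0 : forall n, 0 <= p n)
  (p1 : series p @ \oo --> (1 : R))
  (hp : forall x, 0 <= x < 1 -> psum p x = expR (- (c * (1 - x) `^ alpha))).

Let g := levy_weight alpha.

Let discp : disc_cvg p.
Proof.
apply: (disc_bounded (M := 1)) => n; rewrite ger0_norm// -(cvg_lim _ p1)//.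
apply: (@le_trans _ _ (series p n.+1)).
  by rewrite seriesSr lerDr; apply: sumr_ge0.
apply: nondecreasing_cvgn_le; last exact/cvgP/p1.
by apply: nondecreasing_series.
Qed.

Let discg : disc_cvg g := disc_levy_weight a01.

(** The coefficients of p' = c g' p, which holds on (0, 1) because there
    p = exp (c (g - 1)). *)
Lemma compound_recursion k :
  pseries_diffs p k = c * convol (pseries_diffs g) p k.
Proof.
have dg := disc_diffs discg; have dp := disc_diffs discp.
have dc := disc_convol dg discp.
suff : (fun k => pseries_diffs p k + (- c) * convol (pseries_diffs g) p k) =1
    (fun=> 0).
  by move=> /(_ k)/eqP; rewrite mulNr subr_eq0 => /eqP.
have dcZ := discZ (k := - c) dc.
apply: psum_eq0; first exact: (discD dp dcZ).
move=> x x01; have /andP[x0 x1] := x01.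
have x1' : `|x| < 1 by rewrite gtr0_norm.
rewrite (psumD dp dcZ x1') (psumZ _ dc x1') (psum_convol dg discp x1').
have d1 := psum_derive discp x1'.
have d2 : is_derive x (1 : R) (fun x => expR (c * (psum g x - 1)))
    (expR (c * (psum g x - 1)) * (c * psum (pseries_diffs g) x)).
  apply: (@is_derive1_comp R expR (fun x => c * (psum g x - 1))).
  have d3 := is_deriveZ c (is_deriveB (psum_derive discg x1')
    (is_derive_cst (1 : R) x 1)).
  by apply: (is_derive_eq d3); rewrite subr0.
(* The hypothesis holds on [0, 1) only, so that derivatives are compared in
   the open interval. *)
have hE y : 0 <= y < 1 -> expR (c * (psum g y - 1)) = psum p y.
  move=> y01; rewrite hp// /g psum_levy_weight//; congr expR; ring.
have d4 : is_derive x (1 : R) (psum p)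
    (expR (c * (psum g x - 1)) * (c * psum (pseries_diffs g) x)).
  apply: (near_eq_is_derive _ d2); near=> y; apply: hE.
  apply/andP; split; first by apply/ltW; near: y; exact: lt_nbhsr.
  by near: y; exact: lt_nbhsl.
have -> := esym (@derive_val _ _ _ _ _ _ _ d1).
have -> := @derive_val _ _ _ _ _ _ _ d4.
rewrite hE; last by rewrite ltW.
ring.
Unshelve. all: by end_near. Qed.

Context (theta : R).

(* Real and imaginary parts of the coefficients of r |-> p (r e^(i theta)) and
   r |-> g (r e^(i theta)). *)
Let pc n := p n * cos (n%:R * theta).
Let ps n := p n * sin (n%:R * theta).
Let gc n := g n * cos (n%:R * theta).
Let gs n := g n * sin (n%:R * theta).

Let dpc : disc_cvg pc.
Proof. by apply: disc_mul_bounded => // n; exact: cos_max. Qed.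
Let dps : disc_cvg ps.
Proof. by apply: disc_mul_bounded => // n; exact: sin_max. Qed.
Let dgc : disc_cvg gc.
Proof. by apply: disc_mul_bounded => // n; exact: cos_max. Qed.
Let dgs : disc_cvg gs.
Proof. by apply: disc_mul_bounded => // n; exact: sin_max. Qed.

Let angle k (i : 'I_k.+1) :
  k.+1%:R * theta = i.+1%:R * theta + (k - i)%:R * theta.
Proof. by rewrite -mulrDl -natrD addSn subnKC// -ltnS. Qed.

(** The addition formula for the angle (k + 1) theta turns the real recursion
    into the real part of its rotation by theta; the next lemma is the imaginary
    part. *)
Let diffs_pc k : pseries_diffs pc k =
  c * (convol (pseries_diffs gc) pc k + (- 1) * convol (pseries_diffs gs) ps k).
Proof.
rewrite mulN1r {1}/pseries_diffs /pc mulrA -/(pseries_diffs p k).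
rewrite compound_recursion -mulrA; congr (_ * _).
rewrite /convol mulr_suml -sumrB; apply: eq_bigr => i _.
rewrite (angle i) cosD /pseries_diffs /gc /gs /ps; ring.
Qed.

Let diffs_ps k : pseries_diffs ps k =
  c * (convol (pseries_diffs gs) pc k + convol (pseries_diffs gc) ps k).
Proof.
rewrite {1}/pseries_diffs /ps mulrA -/(pseries_diffs p k).
rewrite compound_recursion -mulrA; congr (_ * _).
rewrite /convol mulr_suml -big_split/=; apply: eq_bigr => i _.
rewrite (angle i) sinD /pseries_diffs /gc /gs /pc; ring.
Qed.

Let dFc x : `|x| < 1 -> psum (pseries_diffs pc) x =
  c * (psum (pseries_diffs gc) x * psum pc x -
       psum (pseries_diffs gs) x * psum ps x).
Proof.
move=> x1; have -> : pseries_diffs pc = _ := funext diffs_pc.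
have dc := disc_convol (disc_diffs dgc) dpc.
have ds := disc_convol (disc_diffs dgs) dps.
have dsN := discZ (k := - 1) ds.
rewrite (psumZ _ (discD dc dsN) x1) (psumD dc dsN x1).
rewrite (psumZ _ ds x1) !psum_convol ?mulN1r//; exact: disc_diffs.
Qed.

Let dFs x : `|x| < 1 -> psum (pseries_diffs ps) x =
  c * (psum (pseries_diffs gs) x * psum pc x +
       psum (pseries_diffs gc) x * psum ps x).
Proof.
move=> x1; have -> : pseries_diffs ps = _ := funext diffs_ps.
have dc := disc_convol (disc_diffs dgs) dpc.
have ds := disc_convol (disc_diffs dgc) dps.
rewrite (psumZ _ (discD dc ds) x1) (psumD dc ds x1).
rewrite !psum_convol//; exact: disc_diffs.
Qed.

Let E x := expR (- c * psum gc x).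
Let C x := cos (c * psum gs x).
Let S x := sin (c * psum gs x).

(** The left-hand sides are the real and imaginary parts of
    p (r e^(i theta)) exp (- c g (r e^(i theta))), whose derivative in r
    vanishes. *)
Let polar x : 0 <= x < 1 ->
  E x * (psum pc x * C x + psum ps x * S x) = p 0%N /\
  E x * (psum ps x * C x - psum pc x * S x) = 0.
Proof.
move=> x01.
have dE z : `|z| < 1 -> is_derive z (1 : R) E
    (E z * (- c * psum (pseries_diffs gc) z)).
  move=> z1; apply: (@is_derive1_comp R expR (fun x => - c * psum gc x)).
  exact: (is_deriveZ (- c) (psum_derive dgc z1)).
have dI z : `|z| < 1 -> is_derive z (1 : R) (fun x => c * psum gs x)
    (c * psum (pseries_diffs gs) z).
  by move=> z1; exact: (is_deriveZ c (psum_derive dgs z1)).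
have dC z : `|z| < 1 -> is_derive z (1 : R) C
    (- S z * (c * psum (pseries_diffs gs) z)).
  by move=> z1; apply: (@is_derive1_comp R cos (fun x => c * psum gs x));
    exact: dI.
have dS z : `|z| < 1 -> is_derive z (1 : R) S
    (C z * (c * psum (pseries_diffs gs) z)).
  by move=> z1; apply: (@is_derive1_comp R sin (fun x => c * psum gs x));
    exact: dI.
pose U z := E z * (psum pc z * C z + psum ps z * S z).
pose V z := E z * (psum ps z * C z - psum pc z * S z).
have dU z : `|z| < 1 -> is_derive z (1 : R) U 0.
  move=> z1.
  have h := is_deriveM (dE z z1) (is_deriveD
    (is_deriveM (psum_derive dpc z1) (dC z z1))
    (is_deriveM (psum_derive dps z1) (dS z z1))).
  apply: (is_derive_eq h); rewrite /GRing.scale/= dFc// dFs//.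
  rewrite !fctE; ring.
have dV z : `|z| < 1 -> is_derive z (1 : R) V 0.
  move=> z1.
  have h := is_deriveM (dE z z1) (is_deriveB
    (is_deriveM (psum_derive dps z1) (dC z z1))
    (is_deriveM (psum_derive dpc z1) (dS z z1))).
  apply: (is_derive_eq h); rewrite /GRing.scale/= dFc// dFs//.
  rewrite !fctE; ring.
have := deriv0_cst dU x01; have := deriv0_cst dV x01.
rewrite /U /V => -> ->; rewrite /E /C /S !psum0 /gc /gs /pc /ps /g /=.
rewrite !mul0r !mulr0 expR0 cos0 sin0 !mulr0 !mulr1 !mul1r addr0.
by split => //; rewrite subr0.
Qed.

Let rect x : 0 <= x < 1 ->
  psum pc x = p 0%N * expR (c * psum gc x) * C x /\
  psum ps x = p 0%N * expR (c * psum gc x) * S x.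
Proof.
move=> x01; have [h1 h2] := polar x01.
have hE : expR (c * psum gc x) * E x = 1.
  by rewrite /E -expRD mulNr subrr expR0.
have hCS : C x ^+ 2 + S x ^+ 2 = 1 by rewrite /C /S cos2Dsin2.
set w := expR (c * psum gc x); set a := psum pc x; set b := psum ps x.
rewrite -/w in hE; rewrite -/a -/b in h1 h2; split.
- transitivity (w * E x * (C x ^+ 2 + S x ^+ 2) * a).
    by rewrite hE hCS !mul1r.
  transitivity (E x * (a * C x + b * S x) * w * C x -
    E x * (b * C x - a * S x) * w * S x); first by ring.
  by rewrite h1 h2 !mul0r subr0.
- transitivity (w * E x * (C x ^+ 2 + S x ^+ 2) * b).
    by rewrite hE hCS !mul1r.
  transitivity (E x * (a * C x + b * S x) * w * S x +
    E x * (b * C x - a * S x) * w * C x); first by ring.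
  by rewrite h1 h2 !mul0r addr0.
Qed.

(** Since p_0 = exp (- c), the limit r -> 1 of
    p (r e^(i theta)) = p_0 exp (c g (r e^(i theta))) is the characteristic
    function of the compound Poisson law with jump law g. *)
Lemma compound_charfun :
  let A := limn (series (fun n => levy_weight alpha n * cos (n%:R * theta))) in
  let B := limn (series (fun n => levy_weight alpha n * sin (n%:R * theta))) in
  series (fun n => p n * cos (n%:R * theta)) @ \oo -->
    expR (c * (A - 1)) * cos (c * B) /\
  series (fun n => p n * sin (n%:R * theta)) @ \oo -->
    expR (c * (A - 1)) * sin (c * B).
Proof.
move=> A B.
have g0 n : 0 <= g n by exact: levy_weight_ge0.
have c1 n : `|cos (n%:R * theta)| <= 1 by exact: cos_max.
have s1 n : `|sin (n%:R * theta)| <= 1 by exact: sin_max.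
have [_ gcA] := abel_limit g0 c1 (cvg_series_levy_weight a01)
  (cvg_psum_levy_weight a01).
have [_ gsB] := abel_limit g0 s1 (cvg_series_levy_weight a01)
  (cvg_psum_levy_weight a01).
have near01 : \forall r \near (1 : R)^'-, 0 <= r < 1.
  near=> r; apply/andP; split; near: r; first exact: nbhs_left_ge.
  exact: nbhs_left_lt.
have cexpR (f : R -> R) (l : R) : f r @[r --> 1^'-] --> l ->
    expR (f r) @[r --> 1^'-] --> expR l.
  by move=> h; apply: continuous_cvg => //; exact: continuous_expR.
have pp : psum p r @[r --> 1^'-] --> (1 : R).
  have h : expR (- (c * (1 - r) `^ alpha)) @[r --> 1^'-] --> expR (- (c * 0)).
    apply: cexpR; apply: cvgN; apply: cvgM; first exact: cvg_cst.
    by apply: cvg_powR_1B; case/andP : a01.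
  rewrite mulr0 oppr0 expR0 in h; apply: cvg_trans h.
  apply: near_eq_cvg; move: near01; apply: filterS => r r01.
  by rewrite hp.
have [cpc pcA] := abel_limit p0 c1 p1 pp.
have [cps psB] := abel_limit p0 s1 p1 pp.
have p0E : p 0%N = expR (- c).
  by rewrite -psum0 hp ?lexx ?ltr01// subr0 powR1 mulr1.
have hB : c * psum gs r @[r --> 1^'-] --> c * B.
  by apply: cvgM; [exact: cvg_cst|exact: gsB].
have hA : p 0%N * expR (c * psum gc r) @[r --> 1^'-] --> expR (c * (A - 1)).
  rewrite mulrBr mulr1 expRD p0E mulrC.
  apply: cvgM; first exact: cvg_cst.
  apply: cexpR.
  by apply: cvgM; [exact: cvg_cst|exact: gcA].
have tr (f h : R -> R) (l l' : R) : f r @[r --> 1^'-] --> l ->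
    h r @[r --> 1^'-] --> l' -> (forall r, 0 <= r < 1 -> f r = h r) -> l = l'.
  move=> fl hl fh; apply: (cvg_unique _ fl) => //.
  apply: cvg_trans hl; apply: near_eq_cvg; move: near01.
  by apply: filterS => r /fh.
split.
- suff <- : limn (series (fun n => p n * cos (n%:R * theta))) =
    expR (c * (A - 1)) * cos (c * B) by [].
  apply: (tr _ _ _ _ pcA _ (fun r r01 => proj1 (rect r01))).
  apply: cvgM => //; apply: continuous_cvg => //; exact: continuous_cos.
- suff <- : limn (series (fun n => p n * sin (n%:R * theta))) =
    expR (c * (A - 1)) * sin (c * B) by [].
  apply: (tr _ _ _ _ psB _ (fun r r01 => proj2 (rect r01))).
  apply: cvgM => //; apply: continuous_cvg => //; exact: continuous_sin.
Unshelve. all: by end_near. Qed.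

End compound.

(** * Poisson process at a random time *)

Section bounded.
Context d (T : measurableType d) (R : realType) (P : probability T R).

Lemma bounded_integrable (f : T -> R) (M : R) :
  measurable_fun setT f -> (forall w, `|f w| <= M) ->
  P.-integrable setT (EFin \o f).
Proof.
move=> mf fM; apply: measurable_bounded_integrable => //.
  exact: fin_num_fun_lty.
exists M; split; first by rewrite num_real.
by move=> x Mx w _ /=; rewrite (le_trans (fM w))// ltW.
Qed.

Lemma bounded_cvg (f_ : (T -> R)^nat) (f : T -> R) (M : R) :
  (forall n, measurable_fun setT (f_ n)) ->
  (forall n w, `|f_ n w| <= M) ->
  (forall w, f_ ^~ w @ \oo --> f w) ->
  (fun n => \int[P]_w f_ n w) @ \oo --> \int[P]_w f w.
Proof.
move=> mf fM ff.
have mf' : measurable_fun setT f.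
  by apply: (measurable_fun_cvg mf) => w _; exact: ff.
have ffM w : `|f w| <= M.
  have h : `|f_ n w| @[n --> \oo] --> `|f w| by exact: cvg_norm.
  by apply: (cvgr_to_le h); near=> n; exact: fM.
apply: fine_cvg; rewrite fineK; last first.
  by apply: integrable_fin_num => //; exact: (bounded_integrable mf' ffM).
apply: (@dominated_cvg _ _ _ P setT measurableT (fun n w => (f_ n w)%:E)
  (fun w => (f w)%:E) (fun=> M%:E)) => //.
- by move=> n; exact/measurable_EFinP.
- by move=> w _; apply: cvg_EFin; [exact: nearW|exact: ff].
- by apply: (@bounded_integrable (fun=> M) `|M|).
- by move=> n w _; rewrite lee_fin.
Unshelve. all: by end_near. Qed.

Lemma Rintegral_sum (f_ : (T -> R)^nat) (M : R) N :
  (forall n, measurable_fun setT (f_ n)) ->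
  (forall n w, `|f_ n w| <= M) ->
  \int[P]_w (\sum_(0 <= k < N) f_ k w) = \sum_(0 <= k < N) \int[P]_w f_ k w.
Proof.
move=> mf fM; elim: N => [|N IHN].
  under eq_Rintegral do rewrite big_geq//.
  by rewrite big_geq// Rintegral_cst// mul0r.
under eq_Rintegral do rewrite big_nat_recr//=.
rewrite RintegralD// ?IHN ?big_nat_recr//; last first.
  exact: (bounded_integrable (mf N) (fM N)).
apply: (@bounded_integrable _ (\sum_(0 <= k < N) M)).
  by apply: measurable_sum.
by move=> w; apply: (le_trans (ler_norm_sum _ _ _)); apply: ler_sum.
Qed.

Lemma Rintegral_indic (A : set T) : measurable A ->
  \int[P]_w \1_A w = fine (P A).
Proof. by move=> mA; rewrite /Rintegral integral_indic// setIT. Qed.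

End bounded.

(** A value x of the random time lies in exactly one cell, and grid_time is the
    right end of that cell, hence strictly greater than x: right limits of a
    path may be taken along it. *)
Definition grid_cell (R : realType) (n a : nat) : set R :=
  `[a%:R / n.+1%:R, a.+1%:R / n.+1%:R[%classic.

Definition grid_time (R : realType) (n a : nat) : R := a.+1%:R / n.+1%:R.

Lemma grid_cellE (R : realType) (n a : nat) (x : R) : 0 <= x ->
  (x \in @grid_cell R n a) = (a == Num.truncn (x * n.+1%:R)).
Proof.
move=> x0; rewrite eq_sym truncn_eq ?mulr_ge0// /grid_cell.
by rewrite mem_setE in_itv/= ler_pdivrMr// ltr_pdivlMr.
Qed.

Lemma sum_pick (R : realType) (m k : nat) (f : nat -> R) : (k < m)%N ->
  \sum_(0 <= a < m) (a == k)%:R * f a = f k.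
Proof.
move=> km; rewrite (bigD1_seq k) ?mem_index_iota ?iota_uniq//= eqxx mul1r.
by rewrite big1 ?addr0// => i /negbTE ->; rewrite mul0r.
Qed.

(** Only one term of the sum is nonzero, the value of f at the end of the cell
    that contains x.  The number n.+1 ^ 2 of cells covers [0, n.+1), which
    eventually contains x. *)
Lemma cvg_grid (R : realType) (x : R) (f : R -> R) (l : R) : 0 <= x ->
  f s @[s --> x^'+] --> l ->
  \sum_(0 <= a < n.+1 ^ 2) \1_(@grid_cell R n a) x * f (grid_time R n a)
    @[n --> \oo] --> l.
Proof.
move=> x0 fl.
have hE : \forall n \near \oo,
    \sum_(0 <= a < n.+1 ^ 2) \1_(@grid_cell R n a) x * f (grid_time R n a) =
    f (grid_time R n (Num.truncn (x * n.+1%:R))).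
  near=> n; under eq_bigr do rewrite indicE grid_cellE//.
  rewrite (@sum_pick _ _ _ (fun a => f (grid_time R n a)))//.
  rewrite truncn_lt_nat ?mulr_ge0// natrX expr2 ltr_pM2r//.
  near: n; exists (Num.truncn x) => // n /= h.
  by rewrite (lt_le_trans (truncnS_gt x))// ler_nat.
have gl : grid_time R n (Num.truncn (x * n.+1%:R)) @[n --> \oo] --> x^'+.
  move=> A /= [e e0 HA].
  suff : \forall n \near \oo, A (grid_time R n (Num.truncn (x * n.+1%:R))).
    by [].
  near=> n; apply: HA.
    have /andP[h1 h2] := truncn_itv (mulr_ge0 x0 (ler0n R n.+1)).
    rewrite /= /grid_time distrC ger0_norm; last first.
      by rewrite subr_ge0 ler_pdivlMr// ltW.
    rewrite ltrBlDr ltr_pdivrMr// mulrDl -natr1.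
    apply: (@le_lt_trans _ _ (x * n.+1%:R + 1)); first by rewrite lerD2r.
    rewrite addrC ltrD2r -ltr_pdivrMl//.
    near: n; exists (Num.truncn (e^-1)) => // n /= h.
    by rewrite mulr1 (lt_le_trans (truncnS_gt _))// ler_nat.
  rewrite /grid_time ltr_pdivlMr//.
  by have /andP[] := truncn_itv (mulr_ge0 x0 (ler0n R n.+1)).
have := cvg_comp _ _ gl fl; apply: cvg_trans; apply: near_eq_cvg.
by move: hE; apply: filterS => n ->.
Unshelve. all: by end_near. Qed.

Lemma grid_sum_le1 (R : realType) (m n : nat) (x : R) (f : R -> R) : 0 <= x ->
  (forall s, 0 < s -> `|f s| <= 1) ->
  `|\sum_(0 <= a < m) \1_(@grid_cell R n a) x * f (grid_time R n a)| <= 1.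
Proof.
move=> x0 f1; under eq_bigr do rewrite indicE grid_cellE//.
set k := Num.truncn _; have [km|mk] := ltnP k m.
  rewrite (@sum_pick _ _ _ (fun a => f (grid_time R n a)))//.
  by apply: f1; rewrite divr_gt0.
rewrite big_nat big1 ?normr0// => i /andP[_ im].
by rewrite (ltn_eqF (leq_trans im mk)) mul0r.
Qed.

(** Agrees with poisson_pmf at positive rates, but is continuous at 0, where
    poisson_pmf is constantly 1; a subordinator may vanish. *)
Definition poisson_weight (R : realType) (x : R) (k : nat) : R :=
  x ^+ k / k`!%:R * expR (- x).

Lemma poisson_weight_ge0 (R : realType) (x : R) k : 0 <= x ->
  0 <= poisson_weight x k.
Proof.
by move=> x0; rewrite mulr_ge0 ?expR_ge0// divr_ge0// exprn_ge0.
Qed.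

Lemma series_expR_le (R : realType) (x : R) n : 0 <= x ->
  \sum_(0 <= k < n) x ^+ k / k`!%:R <= expR x.
Proof.
move=> x0; apply: (@nondecreasing_cvgn_le _ (series (exp_coeff x))).
  by apply: nondecreasing_series => k _ _; exact: exp_coeff_ge0.
exact: is_cvg_series_exp_coeff.
Qed.

Lemma poisson_weight_le1 (R : realType) (x : R) k : 0 <= x ->
  poisson_weight x k <= 1.
Proof.
move=> x0; rewrite /poisson_weight expRN ler_pdivrMr ?expR_gt0// mul1r.
apply: le_trans (series_expR_le k.+1 x0).
rewrite big_nat_recr//= lerDr; apply: sumr_ge0 => i _.
by rewrite divr_ge0// exprn_ge0.
Qed.

Lemma continuous_poisson_weight (R : realType) k :
  continuous (fun x : R => poisson_weight x k).
Proof.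
move=> x; apply: cvgM.
  by apply: cvgM; [exact: exprn_continuous|exact: cvg_cst].
apply: continuous_cvg; first exact: continuous_expR.
by apply: cvgN.
Qed.

(** Integer values at distance less than 1 are equal. *)
Lemma cvg_eq_nat (R : realType) (g : R -> nat) (x : R) (j : nat) :
  (g s)%:R @[s --> x^'+] --> ((g x)%:R : R) ->
  ((g s == j)%:R : R) @[s --> x^'+] --> ((g x == j)%:R : R).
Proof.
move=> /cvgrPdist_lt /(_ 1 ltr01) h.
have : ((g x == j)%:R : R) @[_ --> x^'+] --> ((g x == j)%:R : R).
  exact: cvg_cst.
apply: cvg_trans.
apply: near_eq_cvg; move: h; apply: filterS => s.
have [->//|ne] := eqVneq (g s) (g x).
move=> h; exfalso; move: h; apply/negP; rewrite -leNgt.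
have -> : `|(g x)%:R - (g s)%:R| = (`|(g x)%:Z - (g s)%:Z|)%:~R :> R.
  by rewrite intr_norm rmorphB.
rewrite ler1z -gtz0_ge1 normr_gt0 subr_eq0 eq_sym.
exact: ne.
Qed.

Section subordination.
Context d (T : measurableType d) (R : realType) (P : probability T R).
Context (lambda : R) (N : R -> {RV P >-> nat}) (D : {RV P >-> R}).
Hypotheses (lambda0 : 0 < lambda) (D0 : forall w, 0 <= D w).
Hypothesis rcN : forall w t, 0 <= t ->
  (N s w)%:R @[s --> t^'+] --> ((N t w)%:R : R).

(** On this event the random time lies in the cell a of the grid, and the
    counting process has the value j at the end of the cell. *)
Definition grid_event n a j : set T :=
  (D @^-1` (grid_cell n a)) `&` (N (grid_time R n a) @^-1` [set j]).

Lemma measurable_grid_preimage n a : measurable (D @^-1` (@grid_cell R n a)).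
Proof. by apply: measurable_funPTI; exact: measurable_itv. Qed.

Lemma measurable_grid_event n a j : measurable (grid_event n a j).
Proof.
apply: measurableI; first exact: measurable_grid_preimage.
by apply: measurable_funPTI.
Qed.

Lemma indic_grid_event n a j w : \1_(grid_event n a j) w =
  \1_(@grid_cell R n a) (D w) * (N (grid_time R n a) w == j)%:R :> R.
Proof.
rewrite /grid_event indicI /=; congr (_ * _); rewrite !indicE => //.
by congr ((nat_of_bool _)%:R); apply/idP/idP; rewrite !inE => /eqP.
Qed.

Lemma cvg_grid_event j w :
  \sum_(0 <= a < n.+1 ^ 2) \1_(grid_event n a j) w @[n --> \oo] -->
  ((N (D w) w == j)%:R : R).
Proof.
under eq_fun do under eq_bigr do rewrite indic_grid_event.
apply: (cvg_grid (f := fun s => (N s w == j)%:R)) => //.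
by apply: cvg_eq_nat; exact: rcN.
Qed.

Lemma grid_event_le1 n m j w :
  `|\sum_(0 <= a < m) \1_(grid_event n a j) w| <= 1 :> R.
Proof.
under eq_bigr do rewrite indic_grid_event.
apply: (@grid_sum_le1 _ _ _ _ (fun s => (N s w == j)%:R)) => // s _.
by case: eqP; rewrite ?normr1 ?normr0.
Qed.

Lemma measurable_subordinated j :
  measurable_fun setT (fun w => (N (D w) w == j)%:R : R).
Proof.
apply: (measurable_fun_cvg (h := fun n w =>
  \sum_(0 <= a < n.+1 ^ 2) \1_(grid_event n a j) w)) => [n|w _]; last first.
  exact: cvg_grid_event.
apply: measurable_sum => a; apply: measurable_indic.
exact: measurable_grid_event.
Qed.

(** The law of N (D) obtained by conditioning on D; that it is the law is
    part of joint_pmf. *)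
Definition subordinated_pmf j : R := \int[P]_w poisson_weight (lambda * D w) j.

Lemma measurable_poisson_weight j :
  measurable_fun setT (fun w => poisson_weight (lambda * D w) j).
Proof.
apply: (measurableT_comp
  (f := fun x : R => poisson_weight (lambda * x) j)) => //.
apply: continuous_measurable_fun => x.
apply: (@continuous_comp _ _ _ (fun x => lambda * x)
  (fun y => poisson_weight y j)).
  exact: mulrl_continuous.
exact: continuous_poisson_weight.
Qed.

Lemma cvg_subordinated_pmf j :
  \sum_(0 <= a < n.+1 ^ 2) fine (P (D @^-1` (@grid_cell R n a))) *
    poisson_weight (lambda * grid_time R n a) j
  @[n --> \oo] --> subordinated_pmf j.
Proof.
have wle s : 0 < s -> `|poisson_weight (lambda * s) j| <= 1.
  move=> s0; have ls0 : 0 <= lambda * s by rewrite mulr_ge0 ?ltW.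
  by rewrite ger0_norm ?poisson_weight_le1 ?poisson_weight_ge0.
have gt0 n a : 0 < grid_time R n a by rewrite divr_gt0.
pose F n w := \sum_(0 <= a < n.+1 ^ 2) \1_(@grid_cell R n a) (D w) *
    poisson_weight (lambda * grid_time R n a) j.
have mc n a : measurable_fun setT (fun w => \1_(@grid_cell R n a) (D w) : R).
  exact: (measurable_indic (measurable_grid_preimage n a)).
have mI n a : measurable_fun setT (fun w => \1_(@grid_cell R n a) (D w) *
    poisson_weight (lambda * grid_time R n a) j).
  exact: measurable_funM.
have : \int[P]_w F n w @[n --> \oo] --> subordinated_pmf j.
  apply: (bounded_cvg (M := 1)).
  - by move=> n; apply: measurable_sum.
  - move=> n w.
    exact: (@grid_sum_le1 _ _ _ _ (fun s => poisson_weight (lambda * s) j)).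
  - move=> w.
    apply: (cvg_grid (f := fun s => poisson_weight (lambda * s) j)) => //.
    apply: cvg_at_right_filter.
    apply: (@continuous_comp _ _ _ (fun x => lambda * x)
      (fun y => poisson_weight y j)); first exact: mulrl_continuous.
    exact: continuous_poisson_weight.
apply: cvg_trans; apply: near_eq_cvg; apply: nearW => n; apply/esym.
rewrite (Rintegral_sum _ (M := 1))//; last first.
  move=> a w; rewrite normrM mulr_ile1// ?wle// indicE.
  by case: (_ \in _); rewrite ?normr1 ?normr0.
apply: eq_bigr => a _.
rewrite RintegralZr//; last first.
  apply: (@bounded_integrable _ _ _ P _ 1).
    exact: mc.
  by move=> w; rewrite indicE; case: (_ \in _); rewrite ?normr1 ?normr0.
congr (_ * _).
rewrite -Rintegral_indic; last exact: measurable_grid_preimage.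
by apply: eq_Rintegral => w _; rewrite !indicE.
Qed.

End subordination.

Section joint_law.
Context d (T : measurableType d) (R : realType) (P : probability T R).
Context (lambda1 lambda2 : R) (N1 N2 : R -> {RV P >-> nat})
  (D1 D2 : {RV P >-> R}).
Hypotheses (lambda10 : 0 < lambda1) (D10 : forall w, 0 <= D1 w).
Hypotheses (lambda20 : 0 < lambda2) (D20 : forall w, 0 <= D2 w).
Hypothesis rcN1 : forall w t, 0 <= t ->
  (N1 s w)%:R @[s --> t^'+] --> ((N1 t w)%:R : R).
Hypothesis rcN2 : forall w t, 0 <= t ->
  (N2 s w)%:R @[s --> t^'+] --> ((N2 t w)%:R : R).
Hypothesis grid_indep : forall n a b j k,
  fine (P (grid_event N1 D1 n a j `&` grid_event N2 D2 n b k)) =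
  (fine (P (D1 @^-1` (grid_cell n a))) *
     poisson_weight (lambda1 * grid_time R n a) j) *
  (fine (P (D2 @^-1` (grid_cell n b))) *
     poisson_weight (lambda2 * grid_time R n b) k).

Let X1 w := N1 (D1 w) w.
Let X2 w := N2 (D2 w) w.
Let p1 := subordinated_pmf lambda1 D1.
Let p2 := subordinated_pmf lambda2 D2.

(** Both sides are limits of the same integrals over the grid: pathwise, sums
    of indicators of grid events converge to the indicators on the left, and
    independence turns their integrals into the approximations of the pmfs. *)
Lemma joint_pmf j k :
  \int[P]_w ((X1 w == j)%:R * (X2 w == k)%:R) = p1 j * p2 k.
Proof.
pose I1 n w := \sum_(0 <= a < n.+1 ^ 2) \1_(grid_event N1 D1 n a j) w : R.
pose I2 n w := \sum_(0 <= b < n.+1 ^ 2) \1_(grid_event N2 D2 n b k) w : R.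
have mE1 n a : measurable (grid_event N1 D1 n a j).
  exact: measurable_grid_event.
have mE2 n a : measurable (grid_event N2 D2 n a k).
  exact: measurable_grid_event.
have lim1 : \int[P]_w (I1 n w * I2 n w) @[n --> \oo] -->
    \int[P]_w ((X1 w == j)%:R * (X2 w == k)%:R).
  apply: (bounded_cvg (M := 1)).
  - move=> n; apply: measurable_funM.
      by apply: measurable_sum => a; exact: measurable_indic.
    by apply: measurable_sum => a; exact: measurable_indic.
  - by move=> n w; rewrite normrM mulr_ile1// grid_event_le1.
  - by move=> w; apply: cvgM; apply: cvg_grid_event.
have lim2 : \int[P]_w (I1 n w * I2 n w) @[n --> \oo] --> p1 j * p2 k.
  have : (\sum_(0 <= a < n.+1 ^ 2) fine (P (D1 @^-1` (@grid_cell R n a))) *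
      poisson_weight (lambda1 * grid_time R n a) j) *
    (\sum_(0 <= b < n.+1 ^ 2) fine (P (D2 @^-1` (@grid_cell R n b))) *
      poisson_weight (lambda2 * grid_time R n b) k) @[n --> \oo] -->
      p1 j * p2 k.
    by apply: cvgM; apply: cvg_subordinated_pmf.
  apply: cvg_trans; apply: near_eq_cvg; apply: nearW => n.
  have ind1 (A : set T) w : `|\1_A w : R| <= 1.
    by rewrite indicE; case: (_ \in _); rewrite ?normr1 ?normr0.
  have hI a : \int[P]_w (\1_(grid_event N1 D1 n a j) w * I2 n w) =
     \sum_(0 <= b < n.+1 ^ 2)
       fine (P (grid_event N1 D1 n a j `&` grid_event N2 D2 n b k)).
    under eq_Rintegral do rewrite mulr_sumr.
    rewrite (Rintegral_sum _ (M := 1)).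
    - apply: eq_bigr => b _; rewrite -Rintegral_indic; last exact: measurableI.
      by apply: eq_Rintegral => w _; rewrite indicI.
    - by move=> b; apply: measurable_funM; exact: measurable_indic.
    - by move=> b w; rewrite normrM mulr_ile1.
  under eq_Rintegral do rewrite mulr_suml.
  rewrite (Rintegral_sum _ (M := 1)).
  - rewrite mulr_suml; apply: eq_bigr => a _; rewrite hI mulr_sumr.
    by apply: eq_bigr => b _; rewrite grid_indep.
  - move=> a; apply: measurable_funM; first exact: measurable_indic.
    by apply: measurable_sum => b; exact: measurable_indic.
  - by move=> a w; rewrite normrM mulr_ile1// grid_event_le1.
exact: (cvg_unique _ lim1 lim2).
Qed.

(** Truncating f and g to {0, ..., n - 1} makes both sides finite
    combinations of joint_pmf; being bounded by 1, the truncations pass to the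
    limit. *)
Lemma joint_integral (f g : nat -> R) :
  (forall n, `|f n| <= 1) -> (forall n, `|g n| <= 1) ->
  measurable_fun setT (fun w => f (X1 w) * g (X2 w)) /\
  series (fun j => p1 j * f j) n * series (fun k => p2 k * g k) n
    @[n --> \oo] --> \int[P]_w (f (X1 w) * g (X2 w)).
Proof.
move=> f1 g1.
pose F n w := \sum_(0 <= j < n) f j * (X1 w == j)%:R.
pose G n w := \sum_(0 <= k < n) g k * (X2 w == k)%:R.
have FE (h : nat -> R) n m :
    \sum_(0 <= j < n) h j * (m == j)%:R = if (m < n)%N then h m else 0.
  under eq_bigr do rewrite mulrC eq_sym.
  case: ltnP => mn; first exact: sum_pick.
  rewrite big_nat big1// => i /andP[_ im].
  by rewrite (ltn_eqF (leq_trans im mn)) mul0r.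
have mF n : measurable_fun setT (F n).
  apply: measurable_sum => j; apply: measurable_funM => //.
  exact: (measurable_subordinated D10 rcN1).
have mG n : measurable_fun setT (G n).
  apply: measurable_sum => j; apply: measurable_funM => //.
  exact: (measurable_subordinated D20 rcN2).
have cFG w : F n w * G n w @[n --> \oo] --> f (X1 w) * g (X2 w).
  have : f (X1 w) * g (X2 w) @[n --> \oo] --> f (X1 w) * g (X2 w).
    exact: cvg_cst.
  apply: cvg_trans; apply: near_eq_cvg; near=> n.
  rewrite /F /G !FE; have -> : (X1 w < n)%N by near: n; exists (X1 w).+1.
  by have -> : (X2 w < n)%N by near: n; exists (X2 w).+1.
have mFG n : measurable_fun setT (fun w => F n w * G n w).
  exact: measurable_funM.
split.
  by apply: (measurable_fun_cvg mFG) => w _; exact: cFG.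
have bF n w : `|F n w| <= 1.
  by rewrite /F FE; case: ifP => // _; rewrite normr0.
have bG n w : `|G n w| <= 1.
  by rewrite /G FE; case: ifP => // _; rewrite normr0.
have : \int[P]_w (F n w * G n w) @[n --> \oo] -->
    \int[P]_w (f (X1 w) * g (X2 w)).
  apply: (bounded_cvg (M := 1)) => // n w.
  by rewrite normrM mulr_ile1.
apply: cvg_trans; apply: near_eq_cvg; apply: nearW => n.
have b1 (b : bool) : `|b%:R : R| <= 1.
  by case: b; rewrite ?normr1 ?normr0.
under eq_Rintegral do rewrite mulr_suml.
rewrite (Rintegral_sum _ (M := 1)).
- rewrite mulr_suml; apply: eq_bigr => j _.
  under eq_Rintegral do rewrite mulr_sumr.
  rewrite (Rintegral_sum _ (M := 1)).
  + rewrite mulr_sumr; apply: eq_bigr => k _.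
    transitivity (f j * g k * (p1 j * p2 k)); last by ring.
    rewrite -joint_pmf -RintegralZl//.
      by apply: eq_Rintegral => w _; ring.
    apply: (@bounded_integrable _ _ _ P _ 1).
      by apply: measurable_funM; [exact: (measurable_subordinated D10 rcN1)|
        exact: (measurable_subordinated D20 rcN2)].
    by move=> w; rewrite normrM mulr_ile1.
  + move=> k; apply: measurable_funM; apply: measurable_funM => //.
      exact: (measurable_subordinated D10 rcN1).
    exact: (measurable_subordinated D20 rcN2).
  + by move=> k w; rewrite !normrM mulr_ile1 ?mulr_ile1 ?mulr_ge0.
- move=> j; apply: measurable_funM => //; apply: measurable_funM => //.
  exact: (measurable_subordinated D10 rcN1).
- by move=> j w; rewrite !normrM mulr_ile1 ?mulr_ile1 ?mulr_ge0.
Unshelve. all: by end_near. Qed.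

End joint_law.

Section generating_function.
Context d (T : measurableType d) (R : realType) (P : probability T R).
Context (lambda : R) (D : {RV P >-> R}).
Hypotheses (lambda0 : 0 < lambda) (D0 : forall w, 0 <= D w).

Let p := subordinated_pmf lambda D.
Let lD0 w : 0 <= lambda * D w. Proof. by rewrite mulr_ge0// ltW. Qed.

Lemma subordinated_pmf_ge0 j : 0 <= p j.
Proof. by apply: Rintegral_ge0 => w _; exact: poisson_weight_ge0. Qed.

(** Summing the Poisson weights inside the expectation gives
    exp (lambda D u) exp (- lambda D); the partial sums are bounded by 1. *)
Lemma cvg_subordinated_pgf u : 0 <= u <= 1 ->
  series (fun k => p k * u ^+ k) @ \oo -->
  \int[P]_w expR (- (lambda * (1 - u) * D w)).
Proof.
move=> /andP[u0 u1].
have u01 k : `|u ^+ k| <= 1 by rewrite ger0_norm ?exprn_ge0// exprn_ile1.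
have w01 k w : `|poisson_weight (lambda * D w) k| <= 1.
  by rewrite ger0_norm ?poisson_weight_le1 ?poisson_weight_ge0.
have mw := measurable_poisson_weight lambda D.
pose F n w := \sum_(0 <= k < n) poisson_weight (lambda * D w) k * u ^+ k.
have FE n w : F n w =
    series (exp_coeff (lambda * D w * u)) n * expR (- (lambda * D w)).
  rewrite /F mulr_suml; apply: eq_bigr => k _.
  rewrite /poisson_weight /exp_coeff /= [(_ * u) ^+ k]exprMn.
  by move: (_ ^+ k) (u ^+ k) (expR _) => a b e; ring.
have : \int[P]_w F n w @[n --> \oo] -->
    \int[P]_w expR (- (lambda * (1 - u) * D w)).
  apply: (bounded_cvg (M := 1)).
  - by move=> n; apply: measurable_sum => k; apply: measurable_funM.
  - move=> n w; rewrite FE expRN ger0_norm; last first.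
      rewrite divr_ge0 ?expR_ge0//; apply: sumr_ge0 => i _.
      by rewrite exp_coeff_ge0// mulr_ge0.
    rewrite ler_pdivrMr ?expR_gt0// mul1r.
    apply: (@le_trans _ _ (expR (lambda * D w * u))).
      by apply: series_expR_le; rewrite mulr_ge0.
    by rewrite ler_expR ler_piMr.
  - move=> w; have -> : expR (- (lambda * (1 - u) * D w)) =
      expR (lambda * D w * u) * expR (- (lambda * D w)).
      by rewrite -expRD; congr expR; ring.
    under eq_fun do rewrite FE.
    apply: cvgM; last exact: cvg_cst.
    exact: is_cvg_series_exp_coeff.
apply: cvg_trans; apply: near_eq_cvg; apply: nearW => n.
rewrite (Rintegral_sum _ (M := 1)); last first.
- by move=> k w; rewrite normrM mulr_ile1.
- by move=> k; apply: measurable_funM.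
apply: eq_bigr => k _; rewrite RintegralZr//.
exact: (@bounded_integrable _ _ _ P _ 1).
Qed.

Context (alpha t : R).
Hypothesis alpha0 : 0 < alpha.
Hypothesis laplace : forall s : R, 0 <= s ->
  'E_P[fun w => expR (- (s * D w))]%E = (expR (- (t * s `^ alpha)))%:E.

Let pgf u : 0 <= u <= 1 ->
  series (fun k => p k * u ^+ k) @ \oo -->
  expR (- (t * lambda `^ alpha * (1 - u) `^ alpha)).
Proof.
move=> u01; have /andP[u0 u1] := u01.
have := cvg_subordinated_pgf u01.
suff -> : \int[P]_w expR (- (lambda * (1 - u) * D w)) =
  expR (- (t * lambda `^ alpha * (1 - u) `^ alpha)) by [].
have u1' : 0 <= 1 - u by rewrite subr_ge0.
have := laplace (mulr_ge0 (ltW lambda0) u1').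
rewrite unlock /Rintegral => ->.
by rewrite /= powRM ?mulrA// ltW.
Qed.

Lemma cvg_subordinated_pmf_sum : series p @ \oo --> (1 : R).
Proof.
have := @pgf 1; rewrite ler01 lexx => /(_ isT).
rewrite subrr powR0 ?gt_eqF// mulr0 oppr0 expR0.
by under eq_fun do rewrite expr1n mulr1.
Qed.

Lemma psum_subordinated_pmf u : 0 <= u < 1 ->
  psum p u = expR (- (t * lambda `^ alpha * (1 - u) `^ alpha)).
Proof.
move=> /andP[u0 u1]; apply: cvg_lim => //; apply: pgf.
by rewrite u0 ltW.
Qed.

End generating_function.

(** The increment over [0, s], as the process starts at 0. *)
Lemma poisson_process_pmf d (T : measurableType d) (R : realType)
    (P : probability T R) (lambda : R) (N : R -> {RV P >-> nat}) s j :
  0 < lambda -> poisson_process lambda N -> 0 < s ->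
  P (N s @^-1` [set j]) = (poisson_weight (lambda * s) j)%:E.
Proof.
move=> l0 [cN _ pN] s0; have := pN 0 s j (lexx _) s0.
rewrite subr0 /poisson_pmf mulr_gt0//.
rewrite /poisson_weight => <-; congr (P _); apply/seteqP.
have N0 w : N 0 w = 0%N.
  by have [/eqP] := cN w; rewrite pnatr_eq0 => /eqP.
by split => w /=; rewrite N0 add0n.
Qed.

Lemma process_sigma_algebra_preimage d (T : measurableType d) (R : realType)
    d' (T' : measurableType d') (X : R -> T -> T') t (B : set T') :
  0 <= t -> measurable B -> process_sigma_algebra X (X t @^-1` B).
Proof.
move=> t0 mB; apply: sub_sigma_algebra; exists t => //.
by exists B => //; rewrite setTI.
Qed.

Lemma independent_processes_events d (T : measurableType d) (R : realType)
    (P : probability T R) (N1 N2 : R -> {RV P >-> nat})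
    (D1 D2 : R -> {RV P >-> R}) (s1 s2 t1 t2 : R) (B1 B2 : set nat)
    (C1 C2 : set R) :
  independent_processes N1 N2 D1 D2 ->
  0 <= s1 -> 0 <= s2 -> 0 <= t1 -> 0 <= t2 ->
  measurable C1 -> measurable C2 ->
  P ((D1 t1 @^-1` C1 `&` N1 s1 @^-1` B1) `&`
     (D2 t2 @^-1` C2 `&` N2 s2 @^-1` B2)) =
  (P (D1 t1 @^-1` C1) * P (N1 s1 @^-1` B1) *
   (P (D2 t2 @^-1` C2) * P (N2 s2 @^-1` B2)))%E.
Proof.
move=> hi s10 s20 t10 t20 mC1 mC2.
pose E := fun i : 'I_4 => nth set0 [:: N1 s1 @^-1` B1; N2 s2 @^-1` B2;
  D1 t1 @^-1` C1; D2 t2 @^-1` C2] i.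
have hE : P (\bigcap_(i in [set` [set: 'I_4]%SET]) E i) =
    (\prod_(i in [set: 'I_4]%SET) P (E i))%E.
  apply: hi => i _.
  by case: i => -[|[|[|[|//]]]] i4; exact: process_sigma_algebra_preimage.
have -> : (D1 t1 @^-1` C1 `&` N1 s1 @^-1` B1) `&`
    (D2 t2 @^-1` C2 `&` N2 s2 @^-1` B2) =
    \bigcap_(i in [set` [set: 'I_4]%SET]) E i.
  apply/seteqP; split => w.
    by move=> [[? ?] [? ?]] [[|[|[|[|//]]]] i4] _.
  move=> h; have hw i (i4 : (i < 4)%N) : E (Ordinal i4) w.
    by apply: h; rewrite /= finset.in_setT.
  by do 2!split; [exact: (@hw 2 isT)|exact: (@hw 0 isT)|exact: (@hw 3 isT)|
    exact: (@hw 1 isT)].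
rewrite hE (eq_bigl xpredT); last by move=> i; rewrite finset.in_setT.
rewrite !big_ord_recl big_ord0 mule1 /E /=.
rewrite [RHS]muleACA [RHS]muleC -!muleA; congr (_ * _)%E.
Qed.

(** Real part of the Fourier series of the jump law; levy_sin is its imaginary
    part. *)
Definition levy_cos (R : realType) (alpha theta : R) : R :=
  limn (series (fun n => levy_weight alpha n * cos (n%:R * theta))).

Definition levy_sin (R : realType) (alpha theta : R) : R :=
  limn (series (fun n => levy_weight alpha n * sin (n%:R * theta))).

Section skellam_charfun.
Context (R : realType) (d : measure_display)
  (T : measurableType d) (P : probability T R)
  (lambda1 lambda2 alpha1 alpha2 : R)
  (N1 N2 : R -> {RV P >-> nat}) (D1 D2 : R -> {RV P >-> R}).
Hypotheses (hlambda1 : 0 < lambda1) (hlambda2 : 0 < lambda2)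
  (halpha1 : 0 < alpha1 < 1) (halpha2 : 0 < alpha2 < 1)
  (hN1 : poisson_process lambda1 N1) (hN2 : poisson_process lambda2 N2)
  (hD1 : stable_subordinator alpha1 D1)
  (hD2 : stable_subordinator alpha2 D2)
  (hindep : independent_processes N1 N2 D1 D2).
Context (t theta : R) (t0 : 0 <= t).

Let X1 w := N1 (D1 t w) w.
Let X2 w := N2 (D2 t w) w.

Let subordinator_ge0 alpha D : stable_subordinator alpha D ->
  forall w, 0 <= (D t : {RV P >-> R}) w.
Proof.
by move=> [cD _ _ _] w; have [D0 mD _] := cD w; rewrite -D0 mD.
Qed.

Let poisson_right_cont lambda (N : R -> {RV P >-> nat}) :
  poisson_process lambda N -> forall w s, 0 <= s ->
  (N u w)%:R @[u --> s^'+] --> ((N s w)%:R : R).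
Proof. by move=> [cN _ _] w s s0; have [_ _] := cN w; exact. Qed.

Let grid_indep n a b j k :
  fine (P (grid_event N1 (D1 t) n a j `&` grid_event N2 (D2 t) n b k)) =
  (fine (P (D1 t @^-1` (grid_cell n a))) *
     poisson_weight (lambda1 * grid_time R n a) j) *
  (fine (P (D2 t @^-1` (grid_cell n b))) *
     poisson_weight (lambda2 * grid_time R n b) k).
Proof.
have gt0 m c : 0 < grid_time R m c by rewrite divr_gt0.
rewrite /grid_event independent_processes_events//; do ?exact: measurable_itv;
  do ?exact: ltW.
rewrite (poisson_process_pmf _ hlambda1 hN1)//.
rewrite (poisson_process_pmf _ hlambda2 hN2)//.
have fP (A : set T) : measurable A -> P A \is a fin_num.
  by move=> mA; exact: fin_num_measure.
by rewrite !fineM ?fin_numM ?fP//; exact: measurable_grid_preimage.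
Qed.

Let charfun lambda alpha D : 0 < lambda -> 0 < alpha < 1 ->
    stable_subordinator alpha D ->
  let p := subordinated_pmf lambda (D t : {RV P >-> R}) in
  let c := t * lambda `^ alpha in
  series (fun n => p n * cos (n%:R * theta)) @ \oo -->
    expR (c * (levy_cos alpha theta - 1)) * cos (c * levy_sin alpha theta) /\
  series (fun n => p n * sin (n%:R * theta)) @ \oo -->
    expR (c * (levy_cos alpha theta - 1)) * sin (c * levy_sin alpha theta).
Proof.
move=> l0 a01 hD p c; have /andP[a0 _] := a01.
have D0 := subordinator_ge0 hD.
have laplace s : 0 <= s ->
    'E_P[fun w => expR (- (s * D t w))]%E = (expR (- (t * s `^ alpha)))%:E.
  by move=> s0; have [_ _ _] := hD; exact.
apply: (compound_charfun a01).
- by move=> n; exact: subordinated_pmf_ge0.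
- exact: (cvg_subordinated_pmf_sum l0 D0 a0 laplace).
- by move=> x x01; exact: (psum_subordinated_pmf l0 D0 laplace).
Qed.

Let joint (f g : nat -> R) (a b : R) :
  (forall n, `|f n| <= 1) -> (forall n, `|g n| <= 1) ->
  series (fun n => subordinated_pmf lambda1 (D1 t) n * f n) @ \oo --> a ->
  series (fun n => subordinated_pmf lambda2 (D2 t) n * g n) @ \oo --> b ->
  P.-integrable setT (EFin \o (fun w => f (X1 w) * g (X2 w))) /\
  \int[P]_w (f (X1 w) * g (X2 w)) = a * b.
Proof.
move=> f1 g1 fa gb.
have [mfg lfg] := joint_integral hlambda1 (subordinator_ge0 hD1)
  hlambda2 (subordinator_ge0 hD2) (poisson_right_cont hN1)
  (poisson_right_cont hN2) grid_indep f1 g1.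
split; last by apply: (cvg_unique _ lfg) => //; exact: cvgM.
apply: (@bounded_integrable _ _ _ P _ 1) => // w.
by rewrite normrM mulr_ile1.
Qed.

Let S := space_fractional_skellam N1 N2 D1 D2 t.
Let c1 := t * lambda1 `^ alpha1.
Let c2 := t * lambda2 `^ alpha2.
Let a1 := c1 * (levy_cos alpha1 theta - 1).
Let a2 := c2 * (levy_cos alpha2 theta - 1).
Let b1 := c1 * levy_sin alpha1 theta.
Let b2 := c2 * levy_sin alpha2 theta.

Lemma skellam_cos :
  \int[P]_w cos (theta * S w) = expR (a1 + a2) * cos (b1 - b2).
Proof.
have [C1 S1] := charfun hlambda1 halpha1 hD1.
have [C2 S2] := charfun hlambda2 halpha2 hD2.
have cb n : `|cos (n%:R * theta)| <= 1 by exact: cos_max.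
have sb n : `|sin (n%:R * theta)| <= 1 by exact: sin_max.
have [iC EC] := joint cb cb C1 C2; have [iS ES] := joint sb sb S1 S2.
rewrite /S /space_fractional_skellam.
transitivity (\int[P]_w (cos ((X1 w)%:R * theta) * cos ((X2 w)%:R * theta) +
    sin ((X1 w)%:R * theta) * sin ((X2 w)%:R * theta))).
  by apply: eq_Rintegral => w _; rewrite mulrC mulrBl cosB.
rewrite RintegralD// EC ES expRD cosB -/c1 -/c2 -/a1 -/a2 -/b1 -/b2; ring.
Qed.

Lemma skellam_sin :
  \int[P]_w sin (theta * S w) = expR (a1 + a2) * sin (b1 - b2).
Proof.
have [C1 S1] := charfun hlambda1 halpha1 hD1.
have [C2 S2] := charfun hlambda2 halpha2 hD2.
have cb n : `|cos (n%:R * theta)| <= 1 by exact: cos_max.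
have sb n : `|sin (n%:R * theta)| <= 1 by exact: sin_max.
have [iC EC] := joint sb cb S1 C2; have [iS ES] := joint cb sb C1 S2.
rewrite /S /space_fractional_skellam.
transitivity (\int[P]_w (sin ((X1 w)%:R * theta) * cos ((X2 w)%:R * theta) -
    cos ((X1 w)%:R * theta) * sin ((X2 w)%:R * theta))).
  by apply: eq_Rintegral => w _; rewrite mulrC mulrBl sinB.
rewrite RintegralB// EC ES expRD sinB -/c1 -/c2 -/a1 -/a2 -/b1 -/b2; ring.
Qed.

End skellam_charfun.

(** * The Levy measure and its exponent *)

(** Weights of measures must be manifestly nonnegative; the absolute value
    makes a weight of this type without carrying a proof around. *)
Definition nng_abs (R : realType) (x : R) : {nonneg R} := NngNum (normr_ge0 x).

Lemma nng_absE (R : realType) (x : R) : 0 <= x -> (nng_abs x)%:num = x.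
Proof. exact: ger0_norm. Qed.

Lemma nng_mscaleE d (T : measurableType d) (R : realType) (x : R)
    (m : {measure set T -> \bar R}) A : 0 <= x ->
  (mscale (nng_abs x) m : {measure set T -> \bar R}) A = (x%:E * m A)%E.
Proof. by move=> x0; rewrite -[in RHS](nng_absE x0). Qed.

Section atomic_measure.
Context (R : realType).

Definition atomic_measure (alpha : R) (e : nat -> measurableTypeR R) :
    {measure set (measurableTypeR R) -> \bar R} :=
  mseries (fun n => mscale (nng_abs (levy_weight alpha n)) \d_(e n)) 0.

Lemma atomic_measureE (alpha : R) (e : nat -> measurableTypeR R) A :
  0 < alpha < 1 ->
  atomic_measure alpha e A =
  (\sum_(1 <= n <oo) ((-1) ^+ n.+1 * gbinom alpha n)%:E * \d_(e n) A)%E.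
Proof.
move=> a01; rewrite ereal_series [RHS]eseries_mkcond.
apply: eq_eseriesr => -[|n] _.
  by rewrite nng_mscaleE//= mul0e.
by rewrite nng_mscaleE ?levy_weight_ge0.
Qed.

Lemma cvg_levy_weight_bounded (alpha M : R) (f : R^nat) : 0 < alpha < 1 ->
  (forall n, `|f n| <= M) -> cvgn (series (fun n => levy_weight alpha n * f n)).
Proof.
move=> a01 fM; apply: normed_cvg.
have hM : cvgn (series (fun n => M * levy_weight alpha n)).
  apply: (@is_cvg_seriesZ _ (levy_weight alpha) M).
  exact/cvgP/(cvg_series_levy_weight a01).
apply: (series_le_cvg _ _ _ hM) => n /=.
- exact: normr_ge0.
- by rewrite mulr_ge0 ?levy_weight_ge0// (le_trans _ (fM n)).
- rewrite normrM mulrC (ger0_norm (levy_weight_ge0 n a01)).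
  by rewrite ler_wpM2r ?levy_weight_ge0.
Qed.

Lemma integral_atomic (alpha M : R) (e : nat -> measurableTypeR R)
    (D : set (measurableTypeR R)) (f : measurableTypeR R -> R) :
  0 < alpha < 1 -> measurable D -> (forall n, (0 < n)%N -> D (e n)) ->
  measurable_fun D f -> (forall x, 0 <= f x <= M) ->
  (\int[atomic_measure alpha e]_(x in D) (f x)%:E)%E =
  (limn (series (fun n => levy_weight alpha n * f (e n))))%:E.
Proof.
move=> a01 mD De mf fM.
have f0 x : (0 <= (f x)%:E)%E by rewrite lee_fin; case/andP : (fM x).
have mfE : measurable_fun D (EFin \o f) by exact/measurable_EFinP.
rewrite /atomic_measure ge0_integral_measure_series//.
have cs : cvgn (series (fun n => levy_weight alpha n * f (e n))).
  apply: (@cvg_levy_weight_bounded _ M) => // n.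
  by rewrite ger0_norm; case/andP : (fM (e n)).
rewrite -EFin_lim//; congr (limn _); apply/funext => n /=.
rewrite -sumEFin; apply: eq_bigr => k _.
rewrite ge0_integral_mscale// integral_dirac//=.
rewrite nng_absE ?levy_weight_ge0//.
case: k => [|k]; first by rewrite /= mul0e mul0r.
by rewrite diracE mem_set ?mul1e ?EFinM//; exact: De.
Qed.

End atomic_measure.

Section skellam_levy_measure.
Context (R : realType) (lambda1 alpha1 lambda2 alpha2 : R).
Hypotheses (a01 : 0 < alpha1 < 1) (a02 : 0 < alpha2 < 1).

Let nu1 : {measure set (measurableTypeR R) -> \bar R} :=
  mscale (nng_abs (lambda1 `^ alpha1))
    (atomic_measure alpha1 (fun n => n%:R : R)).

Let nu2 : {measure set (measurableTypeR R) -> \bar R} :=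
  mscale (nng_abs (lambda2 `^ alpha2))
    (atomic_measure alpha2 (fun n => - n%:R : R)).

Definition skellam_levy_measure :
    {measure set (measurableTypeR R) -> \bar R} :=
  measure_add nu1 nu2.

Let nu := skellam_levy_measure.

Lemma skellam_levy_measureE A :
  nu A = skellam_levy_density lambda1 alpha1 lambda2 alpha2 A.
Proof.
transitivity (nu1 A + nu2 A)%E; first exact: measure_addE.
by rewrite !nng_mscaleE ?powR_ge0// !atomic_measureE.
Qed.

Let D : set (measurableTypeR R) := ~` [set 0].

Let mD : measurable D.
Proof. by apply: measurableC; exact: measurable_set1. Qed.

Lemma integral_skellam_levy_measure (M : R) (A : set (measurableTypeR R))
    (f : measurableTypeR R -> R) :
  measurable A -> D `<=` A -> measurable_fun A f -> (forall x, 0 <= f x <= M) ->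
  (\int[nu]_(x in A) (f x)%:E)%E =
  (lambda1 `^ alpha1 * limn (series (fun n => levy_weight alpha1 n * f n%:R)) +
   lambda2 `^ alpha2 *
     limn (series (fun n => levy_weight alpha2 n * f (- n%:R))))%:E.
Proof.
move=> mA DA mf fM.
have f0 x : (0 <= (f x)%:E)%E by rewrite lee_fin; case/andP : (fM x).
have mfE : measurable_fun A (EFin \o f) by exact/measurable_EFinP.
rewrite /nu /skellam_levy_measure ge0_integral_measure_add//.
rewrite !ge0_integral_mscale// !nng_absE ?powR_ge0//.
rewrite (integral_atomic (M := M) a01)//; last first.
  by move=> n n0; apply: DA => /eqP; rewrite pnatr_eq0 gtn_eqF.
rewrite (integral_atomic (M := M) a02)//.
by move=> n n0; apply: DA => /eqP; rewrite oppr_eq0 pnatr_eq0 gtn_eqF.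
Qed.

Lemma skellam_levy_measure_setT :
  nu setT = (lambda1 `^ alpha1 + lambda2 `^ alpha2)%:E.
Proof.
have := @integral_skellam_levy_measure 1 setT (fun=> 1).
rewrite integral_cst// mul1e => ->//.
- have E a : 0 < a < 1 -> limn (series (fun n => levy_weight a n * 1)) = 1 :> R.
    move=> h; under [X in series X]eq_fun do rewrite mulr1.
    exact/cvg_lim/cvg_series_levy_weight.
  by rewrite !E// !mulr1.
- by move=> x; rewrite ler01 lexx.
Qed.

Lemma integrable_skellam_levy_measure (M : R) (A : set (measurableTypeR R))
    (f : measurableTypeR R -> R) : measurable A -> measurable_fun A f ->
  (forall x, `|f x| <= M) -> nu.-integrable A (EFin \o f).
Proof.
move=> mA mf fM; apply: measurable_bounded_integrable => //.
  apply: (@le_lt_trans _ _ (nu setT)); first by apply: le_measure; rewrite ?inE.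
  by rewrite skellam_levy_measure_setT ltry.
exists M; split; first by rewrite num_real.
by move=> x Mx w _ /=; rewrite (le_trans (fM w))// ltW.
Qed.

(** Adding the constant M reduces a bounded f to a nonnegative one, for which
    integration against a series of Dirac masses is termwise. *)
Lemma Rintegral_skellam_levy_measure (M : R) (f : measurableTypeR R -> R) :
  measurable_fun D f -> (forall x, `|f x| <= M) ->
  \int[nu]_(x in D) f x =
  lambda1 `^ alpha1 * limn (series (fun n => levy_weight alpha1 n * f n%:R)) +
  lambda2 `^ alpha2 *
    limn (series (fun n => levy_weight alpha2 n * f (- n%:R))).
Proof.
move=> mf fM.
have M0 : 0 <= M by rewrite (le_trans _ (fM 0)).
have E (h : measurableTypeR R -> R) : measurable_fun D h ->
    (forall x, 0 <= h x <= M + M) -> \int[nu]_(x in D) h x =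
    lambda1 `^ alpha1 * limn (series (fun n => levy_weight alpha1 n * h n%:R)) +
    lambda2 `^ alpha2 *
      limn (series (fun n => levy_weight alpha2 n * h (- n%:R))).
  move=> mh hM.
  by rewrite /Rintegral (integral_skellam_levy_measure (M := M + M)).
have mfM : measurable_fun D (fun x => f x + M) by exact: measurable_funD.
transitivity (\int[nu]_(x in D) ((f x + M) - M)).
  by apply: eq_Rintegral => x _; rewrite addrK.
have hM x : 0 <= f x + M <= M + M.
  have := fM x; rewrite ler_norml => /andP[h1 h2].
  by rewrite lerD2r h2 andbT -lerBlDr sub0r.
rewrite RintegralB//; last 2 first.
- apply: (integrable_skellam_levy_measure (M := M + M)) => // x.
  by rewrite ger0_norm; case/andP : (hM x).
- by apply: (integrable_skellam_levy_measure (M := `|M|)).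
rewrite !E//; last by move=> x; rewrite M0 lerDl.
have L a (e : nat -> R) : 0 < a < 1 ->
    limn (series (fun n => levy_weight a n * f (e n))) =
    limn (series (fun n => levy_weight a n * (f (e n) + M))) -
    limn (series (fun n => levy_weight a n * M)).
  move=> ha; rewrite -lim_seriesB.
  - by congr (limn (series _)); apply/funext => n; rewrite !fctE -mulrBr addrK.
  - apply: (@cvg_levy_weight_bounded _ _ (M + M)) => // n.
    by rewrite ger0_norm; case/andP : (hM (e n)).
  - by apply: (@cvg_levy_weight_bounded _ _ `|M|).
rewrite (L alpha1 (fun n => n%:R))// (L alpha2 (fun n => - n%:R))//; ring.
Qed.

End skellam_levy_measure.

Section cexp.
Context (R : realType).

Lemma Re_cexp_imag (u : R) : complex.Re (cexp (Complex 0 u)) = cos u.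
Proof. by rewrite /cexp /= expR0 mul1r. Qed.

Lemma Im_cexp_imag (u : R) : complex.Im (cexp (Complex 0 u)) = sin u.
Proof. by rewrite /cexp /= expR0 mul1r. Qed.

Lemma Re_cexp_imagB1 (u : R) : complex.Re (cexp (Complex 0 u) - 1) = cos u - 1.
Proof. by rewrite -[cos u]Re_cexp_imag. Qed.

Lemma Im_cexp_imagB1 (u : R) : complex.Im (cexp (Complex 0 u) - 1) = sin u.
Proof. by rewrite -[sin u]Im_cexp_imag -[RHS]subr0. Qed.

Lemma Re_Cintegral_exponent (nu : {measure set (measurableTypeR R) -> \bar R})
    (D : set (measurableTypeR R)) (theta : R) :
  complex.Re (Cintegral nu D (fun x => cexp (Complex 0 (theta * x)) - 1)) =
  \int[nu]_(x in D) (cos (theta * x) - 1).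
Proof. by apply: eq_Rintegral => x _; exact: Re_cexp_imagB1. Qed.

Lemma Im_Cintegral_exponent (nu : {measure set (measurableTypeR R) -> \bar R})
    (D : set (measurableTypeR R)) (theta : R) :
  complex.Im (Cintegral nu D (fun x => cexp (Complex 0 (theta * x)) - 1)) =
  \int[nu]_(x in D) sin (theta * x).
Proof. by apply: eq_Rintegral => x _; exact: Im_cexp_imagB1. Qed.

Lemma scale_complex (t a b : R) :
  Complex t 0 * Complex a b = Complex (t * a) (t * b).
Proof. by congr Complex; rewrite /= !mul0r ?subr0 ?addr0. Qed.

End cexp.

Lemma measurable_trig (R : realType) (theta : R) (h : R -> R)
    (A : set (measurableTypeR R)) : continuous h -> measurable A ->
  measurable_fun A (fun x : measurableTypeR R => h (theta * x)).
Proof.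
move=> ch mA; apply: measurable_funTS.
apply: (@continuous_measurable_fun R (fun x => h (theta * x))) => x.
apply: (@continuous_comp _ _ _ (fun x => theta * x) h); last exact: ch.
exact: mulrl_continuous.
Qed.

Section skellam_is_levy.
Context (R : realType) (d : measure_display)
  (T : measurableType d) (P : probability T R)
  (lambda1 lambda2 alpha1 alpha2 : R)
  (N1 N2 : R -> {RV P >-> nat}) (D1 D2 : R -> {RV P >-> R}).
Hypotheses (hlambda1 : 0 < lambda1) (hlambda2 : 0 < lambda2)
  (halpha1 : 0 < alpha1 < 1) (halpha2 : 0 < alpha2 < 1)
  (hN1 : poisson_process lambda1 N1) (hN2 : poisson_process lambda2 N2)
  (hD1 : stable_subordinator alpha1 D1)
  (hD2 : stable_subordinator alpha2 D2)
  (hindep : independent_processes N1 N2 D1 D2).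

Let nu := skellam_levy_measure lambda1 alpha1 lambda2 alpha2.

Let mD : measurable (~` [set 0] : set (measurableTypeR R)).
Proof. by apply: measurableC; exact: measurable_set1. Qed.

Lemma skellam_levy_measure0 : nu [set 0] = 0%E.
Proof.
rewrite skellam_levy_measureE// /skellam_levy_density.
have d0 (e : nat -> measurableTypeR R) a : (forall n, (0 < n)%N -> e n != 0) ->
    (\sum_(1 <= n <oo) ((-1) ^+ n.+1 * gbinom a n)%:E * \d_(e n) [set 0%R])%E
    = 0%E.
  move=> e0; apply: eseries0 => n n1 _.
  by rewrite diracE memNset ?mule0// => /eqP; apply/negP; exact: e0.
rewrite !d0 ?mule0 ?adde0// => n n0; first by rewrite oppr_eq0 pnatr_eq0 -lt0n.
by rewrite pnatr_eq0 -lt0n.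
Qed.

Lemma skellam_is_levy_measure : is_levy_measure nu.
Proof.
split; first exact: skellam_levy_measure0.
have mm : measurable_fun setT (fun x : measurableTypeR R => Num.min 1 (x ^+ 2)).
  exact: measurable_minr.
have b1 (x : measurableTypeR R) : `|Num.min 1 (x ^+ 2)| <= 1.
  have x2 := sqr_ge0 x.
  by rewrite ger0_norm ?le_min ?ler01//= ge_min lexx.
have /integrableP[_] := integrable_skellam_levy_measure lambda1 lambda2 halpha1
  halpha2 measurableT mm b1.
apply: le_lt_trans; apply: ge0_le_integral => //.
- by move=> x _; rewrite lee_fin le_min ler01 sqr_ge0.
- exact/measurable_EFinP.
- exact/measurableT_comp/measurable_EFinP.
- by move=> x _; rewrite lee_fin ler_norm.
Qed.

Let bcos theta (x : R) : `|cos (theta * x) - 1| <= 2.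
Proof.
by rewrite (le_trans (ler_normB _ _))// normr1 -[2]/(1 + 1) lerD2r cos_max.
Qed.

Let mcos theta : measurable_fun (~` [set 0] : set (measurableTypeR R))
  (fun x : measurableTypeR R => cos (theta * x) - 1).
Proof.
apply: measurable_funB => //.
by apply: measurable_trig => //; exact: continuous_cos.
Qed.

Let msin theta : measurable_fun (~` [set 0] : set (measurableTypeR R))
  (fun x : measurableTypeR R => sin (theta * x)).
Proof. by apply: measurable_trig => //; exact: continuous_sin. Qed.

Lemma skellam_levy_exponent theta :
  Cintegral nu (~` [set 0]) (fun x => cexp (Complex 0 (theta * x)) - 1) =
  Complex
    (lambda1 `^ alpha1 * (levy_cos alpha1 theta - 1) +
     lambda2 `^ alpha2 * (levy_cos alpha2 theta - 1))
    (lambda1 `^ alpha1 * levy_sin alpha1 theta -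
     lambda2 `^ alpha2 * levy_sin alpha2 theta).
Proof.
rewrite /Cintegral; congr Complex.
- under eq_Rintegral do rewrite Re_cexp_imagB1.
  rewrite (Rintegral_skellam_levy_measure _ _ halpha1 halpha2 (mcos theta)
    (bcos theta)).
  have L a (e : nat -> R) : 0 < a < 1 ->
      (forall n, cos (theta * e n) = cos (n%:R * theta)) ->
      limn (series (fun n => levy_weight a n * (cos (theta * e n) - 1))) =
      levy_cos a theta - 1.
    move=> ha he.
    rewrite -[X in _ - X](cvg_lim _ (cvg_series_levy_weight ha))//.
    rewrite /levy_cos -lim_seriesB; last 2 first.
    + by apply: (@cvg_levy_weight_bounded _ _ 1) => // n; exact: cos_max.
    + exact/cvgP/(cvg_series_levy_weight ha).
    congr (limn (series _)); apply/funext => n.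
    by rewrite !fctE he mulrBr mulr1.
  rewrite (L _ (fun n => n%:R))//; last by move=> n; rewrite mulrC.
  by rewrite (L _ (fun n => - n%:R))// => n; rewrite mulrN cosN mulrC.
- under eq_Rintegral do rewrite Im_cexp_imagB1.
  rewrite (Rintegral_skellam_levy_measure _ _ halpha1 halpha2 (M := 1)
    (msin theta)); last by move=> x; exact: sin_max.
  congr (_ * _ + _).
    congr (limn (series _)); apply/funext => n.
    by rewrite [theta * _]mulrC.
  rewrite -mulrN; congr (_ * _); rewrite /levy_sin -limN; last first.
    by apply: (@cvg_levy_weight_bounded _ _ 1) => // n; exact: sin_max.
  rewrite -seriesN.
  congr (limn (series _)); apply/funext => n.
  by rewrite !fctE mulrN sinN mulrN [theta * _]mulrC.
Qed.

(** Multiplied by t, the exponent has the real and imaginary parts found for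
    the characteristic function in skellam_cos and skellam_sin. *)
Lemma skellam_levy_measure_of :
  is_levy_measure_of P (space_fractional_skellam N1 N2 D1 D2) nu.
Proof.
split; first exact: skellam_is_levy_measure.
- move=> theta; split.
  + under eq_fun do rewrite Re_cexp_imagB1.
    exact: (integrable_skellam_levy_measure _ _ halpha1 halpha2 mD (mcos theta)
      (bcos theta)).
  + under eq_fun do rewrite Im_cexp_imagB1.
    apply: (integrable_skellam_levy_measure _ _ halpha1 halpha2 mD (msin theta)
      (M := 1)) => x.
    exact: sin_max.
- move=> t theta t0.
  rewrite skellam_levy_exponent scale_complex /Cintegral /cexp /=.
  under eq_Rintegral do rewrite expR0 mul1r.
  under [X in Complex _ X]eq_Rintegral do rewrite expR0 mul1r.
  rewrite (skellam_cos hlambda1 hlambda2 halpha1 halpha2 hN1 hN2 hD1 hD2)//.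
  rewrite (skellam_sin hlambda1 hlambda2 halpha1 halpha2 hN1 hN2 hD1 hD2)//.
  by rewrite !mulrDr !mulrN !mulrA.
Qed.

End skellam_is_levy.

(** * Uniqueness of the Levy measure *)

Section trigonometry.
Context (R : realType).

Lemma cos_2pi_neq1 (x : R) : 0 < `|x| < 1 -> cos (pi *+ 2 * x) != 1.
Proof.
move=> /andP[x0 x1]; rewrite -cos_norm normrM.
have p0 : 0 < pi :> R by exact: pi_gt0.
have -> : `|pi *+ 2| * `|x| = (pi * `|x|) *+ 2.
  have h : 0 <= pi *+ 2 :> R by rewrite mulrn_wge0// ltW.
  by rewrite (ger0_norm h) mulrnAl.
have : 0 < sin (pi * `|x|).
  by apply: sin_gt0_pi; rewrite mulr_gt0//= gtr_pMr.
rewrite cos_mulr2n cos2sin2 => s0; apply/eqP => h.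
have : sin (pi * `|x|) ^+ 2 = 0 by move: h; lra.
by move/eqP; rewrite sqrf_eq0 gt_eqF.
Qed.

Lemma cos_mul_eq1 (a : R) n : cos a = 1 -> cos (n%:R * a) = 1.
Proof.
move=> ca; have sa : sin a = 0 by apply: cos1sin0; rewrite ca normr1.
elim: n => [|n IHn]; first by rewrite mul0r cos0.
by rewrite -natr1 mulrDl mul1r cosD ca IHn sa mulr0 subr0 mulr1.
Qed.

(** With C and S the sums of cosines and of sines over a full period, shifting
    the index leaves both unchanged while the addition formulas rotate (C, S) by
    the angle a; a rotation with cos a <> 1 fixes only the origin. *)
Lemma sum_cos_eq0 (a : R) N : cos (N%:R * a) = 1 -> cos a != 1 ->
  \sum_(0 <= j < N) cos (j%:R * a) = 0.
Proof.
move=> cN ca.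
have sN : sin (N%:R * a) = 0 by apply: cos1sin0; rewrite cN normr1.
set C := \sum_(_ <= _ < _) _; pose S := \sum_(0 <= j < N) sin (j%:R * a).
have shift (f : nat -> R) : \sum_(0 <= j < N) f j.+1 =
    \sum_(0 <= j < N) f j + f N - f 0%N.
  by rewrite -big_nat_recr//= big_nat_recl//= [f 0%N + _]addrC addrK.
have hC : C = C * cos a - S * sin a.
  have := shift (fun j => cos (j%:R * a)); rewrite cN mul0r cos0 addrK -/C.
  move=> {1}<-; rewrite !mulr_suml -sumrB; apply: eq_bigr => j _.
  by rewrite -natr1 mulrDl mul1r cosD.
have hS : S = S * cos a + C * sin a.
  have := shift (fun j => sin (j%:R * a)); rewrite sN mul0r sin0 addrK -/S.
  move=> {1}<-; rewrite !mulr_suml -big_split/=.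
  by apply: eq_bigr => j _; rewrite -natr1 mulrDl mul1r sinD.
have hc : C * (2 - 2 * cos a) = 0.
  transitivity (C * ((1 - cos a) ^+ 2 + sin a ^+ 2)).
    congr (_ * _); rewrite sin2cos2; ring.
  have e1 : C * (1 - cos a) = - (S * sin a) by move: hC; lra.
  have e2 : S * (1 - cos a) = C * sin a by move: hS; lra.
  rewrite mulrDr expr2 mulrA e1 mulNr mulrAC e2; ring.
move/eqP: hc; rewrite mulf_eq0 => /orP[/eqP//|/eqP h].
by exfalso; move/eqP: ca; apply; lra.
Qed.

Lemma cos_2pi_zmod (x y : R) : cos (pi *+ 2 * x) = 1 -> cos (pi *+ 2 * y) = 1 ->
  cos (pi *+ 2 * (x - y)) = 1.
Proof.
move=> cx cy.
have sx : sin (pi *+ 2 * x) = 0 by apply: cos1sin0; rewrite cx normr1.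
by rewrite mulrBr cosB cx cy sx mul0r addr0 mulr1.
Qed.

End trigonometry.

Section lattice_measure.
Context (R : realType) (nu : {measure set (measurableTypeR R) -> \bar R}).

Local Notation D := (~` [set 0] : set (measurableTypeR R)).

(** The equation cos (2 pi x) = 1 stands for x being an integer; it is the form
    in which integers arise and are used here, both from the vanishing of the
    exponent and in the trigonometric sums. *)
Definition nonzero_ints : set (measurableTypeR R) :=
  [set x | cos (pi *+ 2 * x) = 1] `&` D.

(** The nonzero integers congruent to m modulo N, by the same device. *)
Definition residue_class (N : nat) (m : R) : set (measurableTypeR R) :=
  nonzero_ints `&` [set x | cos (pi *+ 2 / N%:R * (x - m)) = 1].

Hypothesis nuL : is_levy_measure nu.
Hypothesis nuI : forall theta : R, Cintegrable nu D
  (fun x => cexp (Complex 0 (theta * x)) - 1).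
Hypothesis nuZ : \int[nu]_(x in D) (cos (pi *+ 2 * x) - 1) = 0.

Let mD : measurable D.
Proof. by apply: measurableC; exact: measurable_set1. Qed.

Let mcos (k m : R) :
  measurable [set x : measurableTypeR R | cos (k * (x - m)) = 1].
Proof.
have mf : measurable_fun setT (fun x : measurableTypeR R => cos (k * (x - m))).
  apply: (@continuous_measurable_fun R (fun x => cos (k * (x - m)))) => x.
  apply: continuous_comp; last exact: continuous_cos.
  by apply: cvgM; [exact: cvg_cst|apply: cvgB => //; exact: cvg_cst].
have := mf measurableT [set 1] (measurable_set1 1).
by rewrite setTI.
Qed.

Lemma measurable_nonzero_ints : measurable nonzero_ints.
Proof.
apply: measurableI => //; have := mcos (pi *+ 2) 0.
by congr (measurable _); apply/seteqP; split => x /=; rewrite subr0.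
Qed.

Lemma measurable_residue_class N m : measurable (residue_class N m).
Proof. by apply: measurableI => //; exact: measurable_nonzero_ints. Qed.

Let icos theta : nu.-integrable D (EFin \o (fun x => cos (theta * x) - 1)).
Proof.
have [] := nuI theta => + _.
by under eq_fun do rewrite Re_cexp_imagB1.
Qed.

Let isin theta : nu.-integrable D (EFin \o (fun x => sin (theta * x))).
Proof.
have [] := nuI theta => _.
by under eq_fun do rewrite Im_cexp_imagB1.
Qed.

(** The integrand 1 - cos (2 pi x) is nonnegative and has integral 0. *)
Lemma nonzero_ints_full : nu (D `\` nonzero_ints) = 0%E.
Proof.
pose f (x : measurableTypeR R) := (cos (pi *+ 2 * x) - 1)%:E.
have mf : measurable_fun D f by exact: (measurable_int _ (icos _)).
have : (\int[nu]_(x in D) `|f x|)%E = 0%E.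
  have E : (\int[nu]_(x in D) `|f x| = - \int[nu]_(x in D) f x)%E.
    rewrite -integralN//; last first.
      by apply: integrable_add_def => //; exact: (icos (pi *+ 2)).
    apply: eq_integral => x _; by rewrite /f /= ler0_norm ?EFinN.
  rewrite E; have : fine (\int[nu]_(x in D) f x)%E = 0 by exact: nuZ.
  have := integrable_fin_num mD (icos (pi *+ 2)).
  rewrite -/(f _); case: (\int[nu]_(x in D) _)%E => //= r _ ->.
  by rewrite oppr0.
move/(ae_eq_integral_abs nu mD mf) => [N [mN N0 DN]].
apply: (@subset_measure0 _ _ _ nu _ N) => //.
  by apply: measurableD => //; exact: measurable_nonzero_ints.
move=> x [Dx nZ]; apply: DN => /= h; apply: nZ; split => //=.
by have := h Dx; rewrite /f => -[] /eqP; rewrite subr_eq0 => /eqP.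
Qed.

(** A nonzero integer has absolute value at least 1, so that min(1, x^2) = 1
    there, and the latter function is integrable. *)
Lemma nonzero_ints_finite : (nu nonzero_ints < +oo)%E.
Proof.
have [_] := nuL; apply: le_lt_trans.
rewrite -[X in (X <= _)%E]mul1e -integral_cst; last first.
  exact: measurable_nonzero_ints.
have mm : measurable_fun setT
    (fun x : measurableTypeR R => (Num.min 1 (x ^+ 2))%:E).
  apply/measurable_EFinP; exact: measurable_minr.
have m0 (x : measurableTypeR R) : (0 <= (Num.min 1 (x ^+ 2))%:E)%E.
  by rewrite lee_fin le_min ler01 sqr_ge0.
apply: (@le_trans _ _ (\int[nu]_(x in nonzero_ints) (Num.min 1 (x ^+ 2))%:E)%E).
  apply: ge0_le_integral => //.
  - exact: measurable_nonzero_ints.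
  - exact: measurable_funTS.
  - move=> x [/= cx /eqP x0]; rewrite lee_fin le_min lexx /=.
    rewrite -real_normK ?num_real// expr_ge1// leNgt; apply/negP => x1.
    by have := @cos_2pi_neq1 _ x; rewrite normr_gt0 x0 x1 cx eqxx => /(_ isT).
by apply: ge0_subset_integral => //; exact: measurable_nonzero_ints.
Qed.

Lemma residue_class_finite N m : (nu (residue_class N m) < +oo)%E.
Proof.
apply: le_lt_trans nonzero_ints_finite; apply: le_measure; rewrite ?inE.
- exact: measurable_residue_class.
- exact: measurable_nonzero_ints.
- by move=> x [].
Qed.

Lemma measure_nonzero_ints (A : set (measurableTypeR R)) : measurable A ->
  nu A = nu (A `&` nonzero_ints).
Proof.
move=> mA; have mZ := measurable_nonzero_ints.
rewrite (measureDI nu mA mZ) [X in (X + _)%E](_ : _ = 0%E) ?add0e//.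
apply: (@subset_measure0 _ _ _ nu _ ([set 0] `|` (D `\` nonzero_ints))).
- exact: measurableD.
- apply: measurableU; first exact: measurable_set1.
  exact: measurableD.
- move=> x [Ax nZ]; have [->|x0] := eqVneq x 0; first by left.
  by right; split => //; apply/eqP.
- have m0 : measurable ([set 0] : set (measurableTypeR R)).
    exact: measurable_set1.
  have [nu0 _] := nuL.
  exact: (etrans (measureU0 m0 (measurableD mD mZ) nonzero_ints_full) nu0).
Qed.

(** Discrete Fourier inversion: for an integer x, the sum over j < N of
    cos (2 pi j (x - m) / N) is N if x is congruent to m modulo N and 0
    otherwise.  The terms cos (2 pi j m / N), needed to express the sum by the
    exponent, cancel because 0 is not congruent to m modulo N. *)
Lemma measure_residue_class (N : nat) (m : R) : (0 < N)%N ->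
  cos (pi *+ 2 * m) = 1 -> cos (pi *+ 2 / N%:R * m) != 1 ->
  N%:R * fine (nu (residue_class N m)) =
  \sum_(0 <= j < N) (cos (j%:R * (pi *+ 2 / N%:R) * m) *
      \int[nu]_(x in D) (cos (j%:R * (pi *+ 2 / N%:R) * x) - 1) +
    sin (j%:R * (pi *+ 2 / N%:R) * m) *
      \int[nu]_(x in D) sin (j%:R * (pi *+ 2 / N%:R) * x)).
Proof.
move=> N0 cm cmN; set t := pi *+ 2 / N%:R.
have NR0 : N%:R != 0 :> R by rewrite pnatr_eq0 -lt0n.
have Nt : N%:R * t = pi *+ 2 by rewrite /t mulrC divfK.
pose g j (x : measurableTypeR R) :=
  cos (j%:R * t * m) * (cos (j%:R * t * x) - 1) +
  sin (j%:R * t * m) * sin (j%:R * t * x).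
have iD (f1 f2 : measurableTypeR R -> R) : nu.-integrable D (EFin \o f1) ->
    nu.-integrable D (EFin \o f2) ->
    nu.-integrable D (EFin \o (fun x => f1 x + f2 x)).
  by move=> i1 i2; exact: (integrableD mD i1 i2).
have iZ k (f : measurableTypeR R -> R) : nu.-integrable D (EFin \o f) ->
    nu.-integrable D (EFin \o (fun x => k * f x)).
  by move=> i; exact: (integrableZl mD k i).
have ig j : nu.-integrable D (EFin \o g j).
  by apply: iD; apply: iZ; [exact: icos|exact: isin].
have Ig j : \int[nu]_(x in D) g j x =
    cos (j%:R * t * m) * \int[nu]_(x in D) (cos (j%:R * t * x) - 1) +
    sin (j%:R * t * m) * \int[nu]_(x in D) sin (j%:R * t * x).
  transitivity (
      \int[nu]_(x in D) (cos (j%:R * t * m) * (cos (j%:R * t * x) - 1)) +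
      \int[nu]_(x in D) (sin (j%:R * t * m) * sin (j%:R * t * x))).
    exact: (RintegralD mD (iZ _ _ (icos _)) (iZ _ _ (isin _))).
  by rewrite (RintegralZl _ mD (icos _)) (RintegralZl _ mD (isin _)).
under eq_bigr do rewrite -Ig.
have isum M : nu.-integrable D (EFin \o (fun x => \sum_(0 <= j < M) g j x)) /\
    \int[nu]_(x in D) (\sum_(0 <= j < M) g j x) =
    \sum_(0 <= j < M) \int[nu]_(x in D) g j x.
  elim: M => [|M [iM IM]].
    rewrite [RHS]big_geq//; split.
      by under eq_fun do rewrite big_geq//; exact: integrable0.
    by under eq_Rintegral do rewrite big_geq//; rewrite Rintegral_cst// mul0r.
  rewrite big_nat_recr//= -IM -RintegralD//; split.
    by under eq_fun do rewrite big_nat_recr//=; exact: iD.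
  by apply: eq_Rintegral => x _; rewrite big_nat_recr.
have [iN <-] := isum N.
have mZ := measurable_nonzero_ints; have mL := measurable_residue_class N m.
have Zfull : (\int[nu]_(x in D) (\sum_(0 <= j < N) g j x)%:E)%E =
    (\int[nu]_(x in nonzero_ints) (\sum_(0 <= j < N) g j x)%:E)%E.
  rewrite (negligible_integral (N := D `\` nonzero_ints))//.
  - congr (integral _ _ _); apply/seteqP.
    split => [x [Dx /not_andP[//|/contrapT]]//|x].
    by move=> Zx; split; [case: Zx|case].
  - exact: measurableD.
  - exact: nonzero_ints_full.
rewrite /Rintegral Zfull.
transitivity (fine
    (\int[nu]_(x in nonzero_ints) (N%:R * \1_(residue_class N m) x)%:E)%E).
  under eq_integral do rewrite EFinM.
  rewrite ge0_integralZl//; last first.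
    by apply/measurable_EFinP; apply: measurable_funTS; exact: measurable_indic.
  rewrite integral_indic// (_ : _ `&` _ = residue_class N m); last first.
    by apply/seteqP; split => [x []//|x xL]; split => //; case: xL.
  by rewrite fineM// ge0_fin_numE//; exact: residue_class_finite.
congr fine; apply: eq_integral => x; rewrite inE => Zx.
have gE j : g j x = cos (j%:R * (t * (x - m))) - cos (j%:R * (t * m)).
  rewrite mulrBr mulrBr cosB /g !mulrA; ring.
under eq_bigr do rewrite gE.
rewrite sumrB [X in _ - X]sum_cos_eq0 ?subr0//; last by rewrite mulrA Nt.
have cxm : cos (N%:R * (t * (x - m))) = 1.
  by rewrite mulrA Nt; apply: cos_2pi_zmod => //; case: Zx.
congr (_%:E); rewrite indicE.
case: (boolP (x \in _)) => [|xL].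
  rewrite inE => -[_ /= c1].
  under eq_bigr do rewrite cos_mul_eq1//.
  by rewrite sumr_const_nat subn0 mulr1.
rewrite mulr0 sum_cos_eq0//; apply: contra xL => /eqP c1.
by rewrite inE.
Qed.

(** A nonzero x - m is not a multiple of 2^n once 2^n > |x - m|. *)
Lemma cvg_residue_class (m : R) : nonzero_ints m ->
  nu (residue_class (2 ^ n) m) @[n --> \oo] --> nu [set m].
Proof.
move=> Zm.
have <- : \bigcap_n (residue_class (2 ^ n) m) = [set m].
  apply/seteqP; split => [x xL|x ->]; last first.
    by move=> n _; split => //=; rewrite subrr mulr0 cos0.
  apply/eqP; rewrite -subr_eq0; apply/negPn/negP => xm.
  pose n := (Num.truncn `|x - m|).+1.
  have [_ /= c1] := xL n I.
  have h2 : (0 : R) < (2 ^ n)%:R by rewrite ltr0n expn_gt0.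
  have := @cos_2pi_neq1 _ ((x - m) / (2 ^ n)%:R).
  rewrite normrM normfV (gtr0_norm h2) divr_gt0 ?normr_gt0//=.
  rewrite ltr_pdivrMr// mul1r mulrA mulrAC c1 eqxx => /(_ _)/negP[] //.
  by rewrite (lt_trans (truncnS_gt _))// ltr_nat ltn_expl.
apply: nonincreasing_cvg_mu.
- exact: residue_class_finite.
- by move=> n; exact: measurable_residue_class.
- by apply: bigcapT_measurable => n; exact: measurable_residue_class.
- apply/nonincreasing_seqP => n; apply/subsetPset => x [Zx /= c1]; split => //=.
  have -> : pi *+ 2 / (2 ^ n)%:R * (x - m) =
      2%:R * (pi *+ 2 / (2 ^ n.+1)%:R * (x - m)) :> R.
    by rewrite expnS natrM; field; rewrite pnatr_eq0 expn_eq0.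
  exact: cos_mul_eq1.
Qed.

End lattice_measure.

Section uniqueness.
Context (R : realType) (nu nu' : {measure set (measurableTypeR R) -> \bar R}).

Local Notation D := (~` [set 0] : set (measurableTypeR R)).

Hypotheses (nuL : is_levy_measure nu) (nuL' : is_levy_measure nu').
Hypothesis nuI : forall theta : R, Cintegrable nu D
  (fun x => cexp (Complex 0 (theta * x)) - 1).
Hypothesis nuI' : forall theta : R, Cintegrable nu' D
  (fun x => cexp (Complex 0 (theta * x)) - 1).
Hypothesis eq_cos : forall theta : R,
  \int[nu]_(x in D) (cos (theta * x) - 1) =
  \int[nu']_(x in D) (cos (theta * x) - 1).
Hypothesis eq_sin : forall theta : R,
  \int[nu]_(x in D) sin (theta * x) = \int[nu']_(x in D) sin (theta * x).
Hypothesis nuZ' : \int[nu']_(x in D) (cos (pi *+ 2 * x) - 1) = 0.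

Let nuZ : \int[nu]_(x in D) (cos (pi *+ 2 * x) - 1) = 0.
Proof. by rewrite eq_cos. Qed.

Let eq_residue_class N m : (0 < N)%N -> cos (pi *+ 2 * m) = 1 ->
  cos (pi *+ 2 / N%:R * m) != 1 ->
  nu (residue_class N m) = nu' (residue_class N m).
Proof.
move=> N0 cm cmN.
have fin := residue_class_finite nuL N m.
have fin' := residue_class_finite nuL' N m.
rewrite -(@fineK _ (nu _)) ?ge0_fin_numE//.
rewrite -(@fineK _ (nu' _)) ?ge0_fin_numE//; congr (_%:E).
have NR0 : N%:R != 0 :> R by rewrite pnatr_eq0 -lt0n.
apply: (mulfI NR0).
rewrite (measure_residue_class nuL nuI nuZ N0 cm cmN).
rewrite (measure_residue_class nuL' nuI' nuZ' N0 cm cmN).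
by apply: eq_bigr => j _; rewrite eq_cos eq_sin.
Qed.

Let eq_atom m : nonzero_ints m -> nu [set m] = nu' [set m].
Proof.
move=> Zm; have [/= cm /eqP m0] := Zm.
have h := cvg_residue_class nuL Zm; have h' := cvg_residue_class nuL' Zm.
apply: (cvg_unique _ h) => //; apply: cvg_trans h'; apply: near_eq_cvg.
exists (Num.truncn `|m|).+1 => // n /= nm; apply/esym.
have h2 : (0 : R) < (2 ^ n)%:R by rewrite ltr0n expn_gt0.
apply: eq_residue_class => //; first by rewrite expn_gt0.
rewrite mulrAC -mulrA; apply: cos_2pi_neq1.
rewrite normrM normfV (gtr0_norm h2) divr_gt0 ?normr_gt0//=.
rewrite ltr_pdivrMr// mul1r (lt_trans (truncnS_gt _))// ltr_nat.
by rewrite (leq_trans (ltn_expl _ (ltnSn 1)))// leq_pexp2l.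
Qed.

(** Both measures live on the nonzero integers and have the same atoms there:
    the masses of the residue classes of m modulo 2^n are determined by the
    exponent as soon as 2^n > |m|. *)
Lemma levy_measure_unique (A : set (measurableTypeR R)) : measurable A ->
  nu A = nu' A.
Proof.
move=> mA.
rewrite (measure_nonzero_ints nuL nuI nuZ mA).
rewrite (measure_nonzero_ints nuL' nuI' nuZ' mA).
(* Cutting the nonzero integers by their integer part leaves at most one
   point in each piece; pickle numbers the pieces by natural numbers. *)
pose F n : set (measurableTypeR R) :=
  (A `&` @nonzero_ints R) `&` [set x | pickle (Num.floor (x : R)) = n].
have Fsub n x y : F n x -> F n y -> x = y.
  move=> [[_ [/= cx _]] /= fx] [[_ [/= cy _]] /= fy].
  have fxy : Num.floor (x : R) = Num.floor (y : R).
    by apply: (pcan_inj (@pickleK _)); rewrite fx fy.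
  apply/eqP; rewrite -subr_eq0; apply/negPn/negP => xy.
  have xy1 : `|x - y| < 1.
    have := floor_itv (x : R); have := floor_itv (y : R).
    rewrite fxy !intrD ltr_norml => /andP[y1 y2] /andP[x1 x2].
    by apply/andP; split; lra.
  have := @cos_2pi_neq1 R (x - y).
  by rewrite normr_gt0 xy xy1 cos_2pi_zmod// eqxx => /(_ isT).
have FE n : F n = set0 \/ exists2 m, nonzero_ints m & F n = [set m].
  have [->|/set0P[m Fm]] := eqVneq (F n) set0; [by left|right].
  exists m; first by case: Fm => -[].
  by apply/seteqP; split => [x Fx|x ->//]; exact: (Fsub n).
have mF n : measurable (F n).
  by have [->|[m _ ->]] := FE n; [exact: measurable0|exact: measurable_set1].
have tF : trivIset setT F.
  by move=> i j _ _ [x [[_ <-] [_ <-]]].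
have UF : \bigcup_n F n = A `&` @nonzero_ints R.
  apply/seteqP; split => [x [n _ []]//|x Ax].
  by exists (pickle (Num.floor (x : R))).
have mUF : measurable (\bigcup_n F n) by exact: bigcup_measurable.
rewrite -UF !measure_bigcup//.
by apply: eq_eseriesr => n _; have [->|[m Zm ->]] := FE n;
  rewrite ?measure0// eq_atom.
Qed.

End uniqueness.

(** The exponential is not injective on the complex numbers, but the whole
    flow t |-> exp (t z) determines z: moduli give the real part, and a
    difference of imaginary parts would show at the time t that turns it into a
    right angle. *)
Lemma cexp_flow_inj (R : realType) (z w : R[i]) :
  (forall t : R, 0 <= t -> cexp (Complex t 0 * z) = cexp (Complex t 0 * w)) ->
  z = w.
Proof.
case: z => a b; case: w => a' b' h.
have {}h t : 0 <= t ->
    expR (t * a) * cos (t * b) = expR (t * a') * cos (t * b') /\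
    expR (t * a) * sin (t * b) = expR (t * a') * sin (t * b').
  by move=> /h; rewrite !scale_complex /cexp /= => -[].
have aa : a = a'.
  have [h1 h2] := h 1 ler01; rewrite !mul1r in h1 h2.
  have sq (e c s : R) :
      (e * c) ^+ 2 + (e * s) ^+ 2 = e ^+ 2 * (c ^+ 2 + s ^+ 2).
    by ring.
  have e : expR a ^+ 2 = expR a' ^+ 2.
    by rewrite -[LHS]mulr1 -(cos2Dsin2 b) -sq h1 h2 sq cos2Dsin2 mulr1.
  apply: expR_inj; apply/eqP; rewrite -(@eqrXn2 _ 2) ?expR_ge0//.
  exact/eqP.
subst a'; congr Complex; apply/eqP; rewrite -subr_eq0; apply/negPn/negP => bb.
have t0 : 0 <= pi / 2 / `|b - b'| :> R by rewrite !divr_ge0// pi_ge0.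
have [h1 h2] := h _ t0.
have eN0 : expR (pi / 2 / `|b - b'| * a) != 0 by rewrite gt_eqF// expR_gt0.
move/(mulfI eN0): h1 => h1; move/(mulfI eN0): h2 => h2.
have : sin (pi / 2 / `|b - b'| * (b - b')) = 0.
  by rewrite mulrBr sinB h1 h2 mulrC subrr.
have -> : pi / 2 / `|b - b'| * (b - b') = Num.sg (b - b') * (pi / 2).
  rewrite {2}(numEsg (b - b')) mulrCA; congr (_ * _).
  by rewrite divfK// normr_eq0.
rewrite sin_sg sin_pihalf mulr1 => /eqP; rewrite sgr_eq0.
exact/negP.
Qed.

(** The weights sit on integers, so the exponent vanishes at theta = 2 pi. *)
Lemma levy_cos_2pi (R : realType) (alpha : R) : 0 < alpha < 1 ->
  levy_cos alpha (pi *+ 2) = 1.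
Proof.
move=> a01; rewrite /levy_cos -[RHS](cvg_lim _ (cvg_series_levy_weight a01))//.
congr (limn (series _)); apply/funext => n.
by rewrite cos_mul_eq1 ?mulr1// cos2pi.
Qed.

Theorem proposition7p1 (R : realType) (d : measure_display)
    (T : measurableType d) (P : probability T R)
    (lambda1 lambda2 alpha1 alpha2 : R)
    (N1 N2 : R -> {RV P >-> nat}) (D1 D2 : R -> {RV P >-> R})
    (hlambda1 : 0 < lambda1) (hlambda2 : 0 < lambda2)
    (halpha1 : 0 < alpha1 < 1) (halpha2 : 0 < alpha2 < 1)
    (hN1 : poisson_process lambda1 N1) (hN2 : poisson_process lambda2 N2)
    (hD1 : stable_subordinator alpha1 D1)
    (hD2 : stable_subordinator alpha2 D2)
    (hindep : independent_processes N1 N2 D1 D2) :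
  let S := space_fractional_skellam N1 N2 D1 D2 in
  (exists nu : {measure set (measurableTypeR R) -> \bar R},
      is_levy_measure_of P S nu) /\
  (forall nu : {measure set (measurableTypeR R) -> \bar R},
      is_levy_measure_of P S nu ->
      forall A : set (measurableTypeR R), measurable A ->
        nu A = skellam_levy_density lambda1 alpha1 lambda2 alpha2 A).
Proof.
move=> S; have nu0P := skellam_levy_measure_of hlambda1 hlambda2 halpha1 halpha2
  hN1 hN2 hD1 hD2 hindep.
set nu0 := skellam_levy_measure _ _ _ _ in nu0P.
split; first by exists nu0.
move=> nu [nuL nuI nuE] A mA; have [nu0L nu0I nu0E] := nu0P.
rewrite -skellam_levy_measureE// -/nu0.
have eq_exponent theta :
    Cintegral nu (~` [set 0]) (fun x => cexp (Complex 0 (theta * x)) - 1) =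
    Cintegral nu0 (~` [set 0]) (fun x => cexp (Complex 0 (theta * x)) - 1).
  by apply: cexp_flow_inj => t t0; rewrite -nuE// -nu0E.
have eq_cos theta : \int[nu]_(x in ~` [set 0]) (cos (theta * x) - 1) =
    \int[nu0]_(x in ~` [set 0]) (cos (theta * x) - 1).
  by rewrite -!Re_Cintegral_exponent eq_exponent.
have eq_sin theta : \int[nu]_(x in ~` [set 0]) sin (theta * x) =
    \int[nu0]_(x in ~` [set 0]) sin (theta * x).
  by rewrite -!Im_Cintegral_exponent eq_exponent.
apply: (levy_measure_unique nuL nu0L nuI nu0I eq_cos eq_sin) => //.
rewrite -Re_Cintegral_exponent skellam_levy_exponent//=.
by rewrite !levy_cos_2pi// !subrr !mulr0 addr0.
Qed.
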